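(* Let $1\le r\le d$ be integers, let $\Theta\in\mathbb{R}^{d\times r}$ satisfy $\Theta^{\mathsf T}\Theta=I_r$, and let $g:\mathbb{R}^r\to\mathbb{R}$ satisfy the Hölder condition $|g(y)-g(y')|\le C\|y-y'\|^\alpha$ for all $y,y'\in\mathbb{R}^r$, where $C<\infty$ and $0<\alpha\le 1$. Let $f:\mathbb{R}^d\to\mathbb{R}$ be the ridge function $f(x)=g(\Theta^{\mathsf T}x)$, with $x\sim\mathcal{N}(0,I_d)$, and suppose $\sigma^2=\mathrm{Var}(f(x))>0$. Then the mean dimension of $f$ satisfies $$\nu(f)\le\Bigl(\frac{C}{\sigma}\Bigr)^2\,2^{\alpha-1}M_{2\alpha}\sum_{j=1}^d\Bigl(\sum_{k=1}^r\Theta_{jk}^2\Bigr)^{\alpha},$$ where $\sigma^2$ does not depend on $d$ (for fixed $r$ and $g$).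
   Context: $\|\cdot\|$ is the Euclidean norm. For $\eta>-1$, $M_\eta=\int_{-\infty}^\infty|y|^\eta\varphi(y)\,dy=\frac{2^{\eta/2}}{\sqrt{\pi}}\Gamma\bigl(\frac{\eta+1}{2}\bigr)$, where $\varphi$ is the standard Gaussian density. Mean dimension: let $x=(x_1,\dots,x_d)$ have independent components (here $x\sim\mathcal{N}(0,I_d)$) and let $f$ be measurable with $E(f(x)^2)<\infty$. For $u\subseteq\{1,\dots,d\}$ the ANOVA components are defined recursively by $f_u(x)=E(f(x)\mid x_u)-\sum_{v\subsetneq u}f_v(x)$, where $x_u=(x_j)_{j\in u}$, so $f=\sum_u f_u$, the $f_u$ are mutually orthogonal in $L^2$, and $f_\emptyset=E(f(x))$. Put $\sigma_u^2=E(f_u(x)^2)$ for $u\neq\emptyset$ and $\sigma^2_\emptyset=0$, so $\sigma^2=\mathrm{Var}(f(x))=\sum_u\sigma_u^2$. When $\sigma^2>0$, the mean dimension of $f$ is $\nu(f)=\sum_u|u|\sigma_u^2\big/\sum_u\sigma_u^2$. *)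

(* Defs.v *)
From HB Require Import structures.
From mathcomp Require Import all_boot all_order all_algebra.
From mathcomp Require Import all_classical all_reals all_analysis.

Set Implicit Arguments.
Unset Strict Implicit.
Unset Printing Implicit Defensive.

Import Order.TTheory GRing.Theory Num.Theory.
Import numFieldNormedType.Exports.

Local Open Scope classical_set_scope.
Local Open Scope ring_scope.

(* The norm that the library puts on matrices is the sup norm. *)
Definition euclidean_norm (R : realType) n (y : 'cV[R]_n) : R :=
  Num.sqrt (\sum_i y i 0 ^+ 2).

Definition gaussian_abs_moment (R : realType) (eta : R) : R :=
  \int[lebesgue_measure]_y (`|y| `^ eta * normal_pdf 0 1 y).

Definition random_vector disp (T : measurableType disp) (R : realType)
    (P : probability T R) d (X : 'I_d -> {RV P >-> R}) (w : T) : 'cV[R]_d :=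
  \col_j X j w.

Arguments random_vector {disp T R} P {d} X w.

(* Taking some of the [B j] to be [setT] gives the product rule for every
   subfamily. *)
Definition independent_components disp (T : measurableType disp)
    (R : realType) (P : probability T R) d (X : 'I_d -> {RV P >-> R}) : Prop :=
  forall B : 'I_d -> set R, (forall j, measurable (B j)) ->
    P [set w | forall j, B j (X j w)] = (\prod_j P (X j @^-1` B j))%E.

Arguments independent_components {disp T R} P {d} X.

(* X ~ N(0, I_d) *)
Definition standard_gaussian disp (T : measurableType disp)
    (R : realType) (P : probability T R) d (X : 'I_d -> {RV P >-> R}) : Prop :=
  independent_components P X /\
  forall j (B : set R), measurable B -> distribution P (X j) B = normal_prob 0 1 B.

Arguments standard_gaussian {disp T R} P {d} X.

(* h is a version of E(F | <<s G>>). *)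
Definition is_cond_expectation disp (T : measurableType disp) (R : realType)
    (P : probability T R) (G : set (set T)) (F h : T -> R) : Prop :=
  [/\ measurable_fun [set: g_sigma_algebraType G]
        (h : g_sigma_algebraType G -> R),
      P.-integrable setT (EFin \o h) &
      forall A, <<s G >> A ->
        (\int[P]_(w in A) (h w)%:E = \int[P]_(w in A) (F w)%:E)%E].

(* The default value 0 of [xget] is never used when [F] is integrable and
   [G] consists of measurable sets, since a version then exists. *)
Definition cond_expectation disp (T : measurableType disp) (R : realType)
    (P : probability T R) (G : set (set T)) (F : T -> R) : T -> R :=
  xget (cst 0) [set h | is_cond_expectation P G F h].

(* The events generating the sigma-algebra of x_u = (x_j)_(j in u). *)
Definition coordinate_events disp (T : measurableType disp) (R : realType)
    (P : probability T R) d (X : 'I_d -> {RV P >-> R}) (u : {set 'I_d}) :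
    set (set T) :=
  \bigcup_(j in [set` u]) preimage_set_system setT (X j) measurable.

Arguments coordinate_events {disp T R} P {d} X u.

Section anova.
Context disp (T : measurableType disp) (R : realType) (P : probability T R).
Variables (d : nat) (X : 'I_d -> {RV P >-> R}) (f : 'cV[R]_d -> R).

(* Any [n > #|u|] gives the same function; see [anovaE]. *)
Fixpoint anova_rec (n : nat) (u : {set 'I_d}) : T -> R :=
  if n is m.+1 then fun w =>
    cond_expectation P (coordinate_events P X u) (f \o random_vector P X) w
    - \sum_(v : {set 'I_d} | v \proper u) anova_rec m v w
  else cst 0.

(* The random variable f_u(x). *)
Definition anova (u : {set 'I_d}) : T -> R := anova_rec #|u|.+1 u.

Lemma anovaE u w :
  anova u w =
  cond_expectation P (coordinate_events P X u) (f \o random_vector P X) w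
  - \sum_(v : {set 'I_d} | v \proper u) anova v w.
Proof.
have recE n m (v : {set 'I_d}) : (#|v| < n)%N -> (#|v| < m)%N ->
    anova_rec n v = anova_rec m v.
  elim: n m v => [|n IH] [|m] v //; rewrite !ltnS => vn vm.
  apply/funext => z /=; congr (_ - _); apply: eq_bigr => t /proper_card tv.
  by rewrite (IH m)// (leq_trans tv).
rewrite {1}/anova /=; congr (_ - _); apply: eq_bigr => v /proper_card vu.
by rewrite (recE _ #|v|.+1).
Qed.

Definition anova_variance (u : {set 'I_d}) : R :=
  if u == finset.set0 then 0 else fine 'E_P[fun w => anova u w ^+ 2].

Definition mean_dimension : R :=
  (\sum_(u : {set 'I_d}) #|u|%:R * anova_variance u) /
  (\sum_(u : {set 'I_d}) anova_variance u).

End anova.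

Arguments anova {disp T R} P {d} X f u _.
Arguments anova_variance {disp T R} P {d} X f u.
Arguments mean_dimension {disp T R} P {d} X f.

Definition ridge (R : realType) d r (Theta : 'M[R]_(d, r))
    (g : 'cV[R]_r -> R) (x : 'cV[R]_d) : R := g (Theta^T *m x).

(* Main.v *)
From HB Require Import structures.
Require Import Defs.
From mathcomp Require Import all_boot all_order all_algebra.
From mathcomp Require Import all_classical all_reals all_analysis.
From mathcomp Require Import measurable_realfun ring lra.

(** A centred function of independent coordinates is split, one coordinate at a
    time, into its average [avg j f] over [x_j] and the residual [res j f], which
    are orthogonal.  Iterating over any enumeration of the coordinates produces
    the ANOVA components, so enumerating [j] first shows that
    [\sum_(u | j \in u) sigma_u^2 = E (res j f)^2].  Conditionally on the other
    coordinates this is a one-dimensional variance, i.e. half of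
    [E (f (x with x_j := z) - f (x with x_j := z'))^2], and the Hoelder condition
    bounds it by [C^2 |Theta_j|^(2 alpha) E |z - z'|^(2 alpha) / 2] with
    [z - z' ~ N(0, 2)].

    For the invariance of the variance, [E h (Theta^T x)] is an iterated Gaussian
    smoothing of [h] along the rows of [Theta].  Rotating two directions into each
    other does not change the result, so Givens elimination replaces the rows by
    the canonical basis of [R^r]. *)

Set Implicit Arguments.
Unset Strict Implicit.
Unset Printing Implicit Defensive.

Import Order.TTheory GRing.Theory Num.Theory.
Import numFieldNormedType.Exports.

Local Open Scope classical_set_scope.
Local Open Scope ring_scope.

(** * The Gaussian measure on the line *)

(** The ANOVA components come from versions of conditional expectations picked by choice, so they
    are determined only up to null sets; explicit iterated averages replace them before any second
    moment is computed. What makes this possible is a Hoelder class measured coordinate by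
    coordinate: it is stable under [avg] and [res], and its members are measurable and square
    integrable. The constant of that class serves regularity only; the bound itself uses one Hoelder
    constant per coordinate. The mean dimension is reached by double counting: weighting [sigma_u^2]
    by [#|u|] amounts to summing, over all [j], the variances of the sets that contain [j]. The
    factor [2 ^ (alpha - 1)] is the factor [2 ^ alpha] of the moment of [z - z'], halved. Rotations
    are performed on nonnegative extended functions, where Tonelli asks for no finiteness; means are
    recovered from positive and negative parts. *)

Definition image_measure d d' (T1 : measurableType d) (T2 : measurableType d')
    (R : realType) (m : {measure set T1 -> \bar R}) (f : T1 -> T2)
    (mf : measurable_fun setT f) : {measure set T2 -> \bar R} :=
  measure_function_pushforward__canonical__measure_function_Measure m mf.

(* [lebesgue_measure] and [normal_prob] live on [measurableTypeR R], whose display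
   differs from the one of the canonical measurable structure on [R]; [leb] and
   [gauss] are their copies on the latter. *)
Section real_line_copies.
Variable R : realType.
Local Notation RR := (measurableTypeR R).

Definition real_id : RR -> R := idfun.

Lemma measurable_real_id : measurable_fun setT real_id.
Proof. by move=> _ A mA; rewrite setTI. Qed.

Definition leb : set R -> \bar R := pushforward (@lebesgue_measure R) real_id.

HB.instance Definition _ := Measure.copy leb
  (image_measure (@lebesgue_measure R) measurable_real_id).

Lemma sigma_finite_leb : sigma_finite setT leb.
Proof.
have [F FT Fp] := sigma_finiteT (@lebesgue_measure R).
by exists F.
Qed.

HB.instance Definition _ := Measure_isSigmaFinite.Build _ _ _ leb sigma_finite_leb.

Definition gauss : set R -> \bar R := pushforward (@normal_prob R 0 1) real_id.

HB.instance Definition _ := Measure.copy gauss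
  (image_measure (@normal_prob R 0 1) measurable_real_id).

Lemma gauss_setT : gauss setT = 1%E.
Proof. exact: (@probability_setT _ _ _ (@normal_prob R 0 1)). Qed.

HB.instance Definition _ := Measure_isProbability.Build _ _ _ gauss gauss_setT.

Lemma ge0_integral_leb (f : R -> \bar R) :
  measurable_fun setT f -> (forall x, 0 <= f x)%E ->
  (\int[leb]_x f x = \int[lebesgue_measure]_x f x)%E.
Proof.
move=> mf f0; rewrite (ge0_integral_pushforward measurable_real_id)//.
Qed.

End real_line_copies.
Arguments leb : clear implicits.
Arguments gauss : clear implicits.

Lemma mule_EFinI (R : realType) (a : R) : a != 0 -> injective (mule a%:E).
Proof.
move=> a0 x y /(congr1 (fun t => (a^-1%:E * t)%E)).
by rewrite !muleA -EFinM mulVf// !mul1e.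
Qed.

Section gaussian.
Variable R : realType.
Local Notation RR := (measurableTypeR R).
Local Notation mu := (@lebesgue_measure R).
Local Notation phi := (@normal_pdf R 0 1).
Local Notation N01 := (@normal_prob R 0 1).

(** The density and the Radon-Nikodym derivative of [normal_prob] have the same integral over every
    measurable set, so they agree almost everywhere. *)
Lemma ge0_integral_normal_prob (f : RR -> \bar R) :
  measurable_fun setT f -> (forall x, 0 <= f x)%E ->
  (\int[N01]_x f x = \int[mu]_x (f x * (phi x)%:E))%E.
Proof.
move=> mf f0; have dom := @normal_prob_dominates R 0 1.
rewrite -(Radon_Nikodym_SigmaFinite.change_of_variables dom)//.
have mRN : measurable_fun setT (Radon_Nikodym_SigmaFinite.f N01 mu).
  exact: (measurable_int _ (Radon_Nikodym_SigmaFinite.f_integrable dom)).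
have mphi : measurable_fun setT (fun x : RR => (phi x)%:E).
  by apply/measurable_EFinP; exact: measurable_normal_pdf.
apply: ge0_ae_eq_integral => //.
- exact: emeasurable_funM.
- exact: emeasurable_funM.
- by move=> x _; rewrite mule_ge0// Radon_Nikodym_SigmaFinite.f_ge0.
- by move=> x _; rewrite mule_ge0// lee_fin normal_pdf_ge0.
apply: ae_eqe_mul2l.
apply: integral_ae_eq => //.
  exact: Radon_Nikodym_SigmaFinite.f_integrable.
by move=> E _ mE; rewrite -Radon_Nikodym_SigmaFinite.f_integral.
Qed.

Lemma measurable_affine (a b : R) :
  measurable_fun setT ((fun x => a * x + b) : RR -> RR).
Proof. by apply: measurable_funD => //; exact: measurable_funM. Qed.

(** Both sides are measures in [A]; by uniqueness of Lebesgue measure it is enough to compare them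
    on half-open intervals. *)
Lemma lebesgue_measure_affine (a b : R) (A : set RR) : a != 0 ->
  measurable A ->
  (`|a|%:E * mu ((fun x => a * x + b)%R @^-1` A) = mu A)%E.
Proof.
move=> a0 mA; have mT := measurable_affine a b.
have a_ge0 : 0 <= `|a| by [].
pose nu := mscale (NngNum a_ge0) (image_measure mu mT).
rewrite [RHS](@lebesgue_measure_unique R nu)//.
move=> _ [[u v]] /= _ <-.
rewrite /nu /mscale/= /pushforward lebesgue_measure_itv/=.
(* In spite of its name, the first case is [a < 0]: the preimage of an interval is then reversed and
   closed on the left. *)
have [a_gt0|a_lt0|/eqP] := ltgtP a 0; last by rewrite (negbTE a0).
- rewrite (_ : _ @^-1` _ = `[(v - b) / a, (u - b) / a[%classic); last first.
    apply/seteqP; split => x /=; rewrite !in_itv/= ler_ndivrMr// ltr_ndivlMr//;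
      by rewrite ltrBlDr lerBrDr (mulrC x) andbC.
  rewrite lebesgue_measure_itv/= !lte_fin ltr_nM2r ?invr_lt0// ltrD2r.
  case: ifPn => uv; rewrite ?mule0//.
  rewrite -!EFinB -EFinM; congr EFin.
  by rewrite ltr0_norm//; field.
- rewrite (_ : _ @^-1` _ = `](u - b) / a, (v - b) / a]%classic); last first.
    apply/seteqP; split => x /=; rewrite !in_itv/= ler_pdivlMr// ltr_pdivrMr//;
      by rewrite ltrBlDr lerBrDr (mulrC x).
  rewrite lebesgue_measure_itv/= !lte_fin ltr_pM2r ?invr_gt0// ltrD2r.
  case: ifPn => uv; rewrite ?mule0//.
  rewrite -!EFinB -EFinM; congr EFin.
  by rewrite gtr0_norm//; field.
Qed.

Lemma ge0_integral_affine (a b : R) (f : RR -> \bar R) : a != 0 ->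
  measurable_fun setT f -> (forall x, 0 <= f x)%E ->
  (\int[mu]_x f x = `|a|%:E * \int[mu]_x f (a * x + b)%R)%E.
Proof.
move=> a0 mf f0; have mT := measurable_affine a b.
have a_ge0 : 0 <= `|a| by [].
transitivity (\int[mscale (NngNum a_ge0) (image_measure mu mT)]_x f x)%E.
  apply: eq_measure_integral => A mA _.
  exact/esym/(lebesgue_measure_affine b a0).
rewrite ge0_integral_mscale//; congr (_ * _)%E.
by rewrite ge0_integral_pushforward.
Qed.

Lemma ge0_integral_gauss (f : R -> \bar R) :
  measurable_fun setT f -> (forall x, 0 <= f x)%E ->
  (\int[gauss R]_x f x = \int[leb R]_x (f x * (phi x)%:E))%E.
Proof.
move=> mf f0; rewrite ge0_integral_leb//; first last.
- by move=> x; rewrite mule_ge0// lee_fin normal_pdf_ge0.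
- apply: emeasurable_funM => //.
  by apply/measurable_EFinP; exact: measurable_normal_pdf.
rewrite (ge0_integral_pushforward (@measurable_real_id R))//.
exact: ge0_integral_normal_prob.
Qed.

Lemma ge0_integral_leb_affine (a b : R) (f : R -> \bar R) : a != 0 ->
  measurable_fun setT f -> (forall x, 0 <= f x)%E ->
  (\int[leb R]_x f x = `|a|%:E * \int[leb R]_x f (a * x + b)%R)%E.
Proof.
move=> a0 mf f0; rewrite !ge0_integral_leb//; last first.
  apply: measurableT_comp => //.
  by apply: measurable_funD => //; exact: measurable_funM.
exact: ge0_integral_affine.
Qed.

(** The Gaussian shape enters [gaussian_rotation] only here: the product density is radial. *)
Lemma normal_pdfM (x y x' y' : R) : x ^+ 2 + y ^+ 2 = x' ^+ 2 + y' ^+ 2 ->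
  phi x * phi y = phi x' * phi y'.
Proof.
move=> e; rewrite !normal_pdfE ?oner_neq0//= /normal_fun !subr0.
rewrite mulrACA [RHS]mulrACA -!expRD; congr (_ * expR _).
by rewrite -!mulrDl -!opprD e.
Qed.

Lemma measurable_lincomb (a b : R) :
  measurable_fun setT ((fun z => a * z.1 + b * z.2) : R * R -> R).
Proof. by apply: measurable_funD; apply: measurable_funM. Qed.

Lemma measurable_normal_pdf1 d (T : measurableType d) (f : T -> R) :
  measurable_fun setT f -> measurable_fun setT (fun x => phi (f x)).
Proof. by move=> mf; apply: (measurableT_comp (measurable_normal_pdf 0 1)). Qed.

Lemma ge0_integral_gauss2 (H : R * R -> \bar R) :
  measurable_fun setT H -> (forall z, 0 <= H z)%E ->
  (\int[gauss R]_x \int[gauss R]_y H (x, y) =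
   \int[leb R]_x \int[leb R]_y (H (x, y) * (phi x * phi y)%:E))%E.
Proof.
move=> mH H0; have mF := measurable_fun_fubini_tonelli_F (m2 := gauss R) H mH H0.
rewrite ge0_integral_gauss//; last by move=> x; exact: integral_ge0.
apply: eq_integral => x _.
have mHx : measurable_fun setT (fun y => H (x, y)) by exact: measurableT_comp.
rewrite ge0_integral_gauss// -ge0_integralZr//.
- by apply: eq_integral => y _; rewrite EFinM -muleA [(_%:E * (phi x)%:E)%E]muleC.
- apply: emeasurable_funM => //.
  by apply/measurable_EFinP; exact: measurable_normal_pdf1.
- by move=> y _; rewrite mule_ge0// lee_fin normal_pdf_ge0.
- by rewrite lee_fin normal_pdf_ge0.
Qed.

(** The rotation is carried out as two affine substitutions on the line, [u = c x + s y] at fixed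
    [y], then [v = (y - s u) / c] at fixed [u], with Tonelli around them. The Jacobians [|c|] and
    [1 / |c|] cancel. *)
Lemma gaussian_rotation (c s : R) (H : R * R -> \bar R) : c != 0 ->
  c ^+ 2 + s ^+ 2 = 1 -> measurable_fun setT H -> (forall z, 0 <= H z)%E ->
  (\int[gauss R]_x \int[gauss R]_y H (c * x + s * y, c * y - s * x)%R =
   \int[gauss R]_x \int[gauss R]_y H (x, y))%E.
Proof.
move=> c0 cs mH H0.
have mrot : measurable_fun setT
    ((fun z => (c * z.1 + s * z.2, c * z.2 - s * z.1)) : R * R -> R * R).
  apply/measurable_fun_pairP; split => /=; first exact: measurable_lincomb.
  by apply: measurable_funB; apply: measurable_funM.
pose rot z := H (c * z.1 + s * z.2, c * z.2 - s * z.1).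
have mrotH : measurable_fun setT rot by exact: measurableT_comp.
have rot0 z : (0 <= rot z)%E by exact: H0.
apply: (etrans (ge0_integral_gauss2 mrotH rot0)).
apply: (etrans _ (esym (ge0_integral_gauss2 mH H0))).
have mphi2 : measurable_fun setT (fun z : R * R => (phi z.1 * phi z.2)%:E).
  apply/measurable_EFinP; apply: measurable_funM.
    exact: measurable_normal_pdf1.
  exact: measurable_normal_pdf1.
have phi2_ge0 x y : (0 <= (phi x * phi y)%:E)%E.
  by rewrite lee_fin mulr_ge0// normal_pdf_ge0.
(* The integrand in the mixed variables [z = (y, u)], where [x = (u - s y) / c] and the second
   argument of [H] is [(y - s u) / c]. *)
pose G (z : R * R) := (H (z.2, ((z.1 - s * z.2) / c)%R) *
  (phi ((z.2 - s * z.1) / c) * phi z.1)%:E)%E.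
have mG : measurable_fun setT G.
  have mdiv (f g : R * R -> R) : measurable_fun setT f ->
      measurable_fun setT g -> measurable_fun setT (fun z => (f z - s * g z) / c).
    move=> mf mg; apply: measurable_funM => //; apply: measurable_funB => //.
    exact: measurable_funM.
  apply: emeasurable_funM.
    apply: measurableT_comp => //; apply/measurable_fun_pairP; split.
      exact: measurable_snd.
    exact: (mdiv fst snd).
  apply/measurable_EFinP; apply: measurable_funM.
    by apply: measurable_normal_pdf1; exact: (mdiv snd fst).
  exact: measurable_normal_pdf1.
have G0 z : (0 <= G z)%E by rewrite mule_ge0.
(* The extra factor [|c|] absorbs the Jacobian of the first substitution; it can be cancelled even
   if the integrals are infinite. *)
apply: (@mule_EFinI _ `|c|); first by rewrite normr_eq0.
pose rotphi z := (rot z * (phi z.1 * phi z.2)%:E)%E.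
pose Hphi z := (H z * (phi z.1 * phi z.2)%:E)%E.
have mrotphi : measurable_fun setT rotphi by exact: emeasurable_funM.
have mHphi : measurable_fun setT Hphi by exact: emeasurable_funM.
have rotphi0 z : (0 <= rotphi z)%E by rewrite mule_ge0.
have Hphi0 z : (0 <= Hphi z)%E by rewrite mule_ge0.
apply: (@etrans _ _ (\int[leb R]_y \int[leb R]_u G (y, u))%E).
  apply: (etrans (congr1 (mule `|c|%:E)
    (@fubini_tonelli _ _ _ _ _ (leb R) (leb R) rotphi mrotphi rotphi0))).
  apply: (etrans (esym (ge0_integralZl _ _ _ _ _))); [by []|..|by rewrite lee_fin|].
  - exact: (measurable_fun_fubini_tonelli_G rotphi).
  - by move=> y _; exact: integral_ge0.
  apply: eq_integral => y _.
  have mGy : measurable_fun setT (fun u => G (y, u)) by exact: measurableT_comp.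
  apply: (etrans _ (esym (ge0_integral_leb_affine (s * y) c0 mGy (fun u => G0 (y, u))))).
  apply: (congr1 (mule _)); apply: eq_integral => x _.
  rewrite /G /rotphi /rot/=.
  have <- : c * y - s * x = (y - s * (c * x + s * y)) / c.
    apply: (mulIf c0); rewrite divfK// -{2}[y]mul1r -cs; ring.
  by have <- : x = (c * x + s * y - s * y) / c by field.
apply: (etrans (@fubini_tonelli _ _ _ _ _ (leb R) (leb R) G mG G0)).
apply: (etrans _ (ge0_integralZl _ _ _ _ _)); [|by []|..|by rewrite lee_fin]; first last.
- by move=> x _; apply: integral_ge0 => y _; exact: (Hphi0 (x, y)).
- exact: (measurable_fun_fubini_tonelli_F Hphi).
apply: eq_integral => u _.
have ci0 : c^-1 != 0 by rewrite invr_neq0.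
pose K v := Hphi (u, v).
have mK : measurable_fun setT K by exact: measurableT_comp.
have K0 v : (0 <= K v)%E by exact: Hphi0.
have := ge0_integral_leb_affine (- s * u / c) ci0 mK K0.
move=> /(congr1 (fun t => (`|c|%:E * t)%E)) /esym; apply: etrans.
rewrite muleA -EFinM normfV divff ?normr_eq0// mul1e.
apply: eq_integral => y _; rewrite /G /K /Hphi/=.
have -> : c^-1 * y + - s * u / c = (y - s * u) / c by field.
congr (_ * _%:E)%E; apply: normal_pdfM.
apply: (mulfI (expf_neq0 2 c0)).
transitivity (c ^+ 2 * y ^+ 2 + (u - s * y) ^+ 2); first by field.
transitivity (c ^+ 2 * u ^+ 2 + (y - s * u) ^+ 2); last by field.
transitivity (u ^+ 2 - 2 * s * u * y + (c ^+ 2 + s ^+ 2) * y ^+ 2); first by ring.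
transitivity ((c ^+ 2 + s ^+ 2) * u ^+ 2 - 2 * s * u * y + y ^+ 2); last by ring.
by rewrite cs; ring.
Qed.

End gaussian.

(** * Absolute moments of the standard Gaussian *)

Section gaussian_moments.
Variable R : realType.

(* [t * exp (- t) <= 1] with [t = x^2 / 4] compares [x^2] times the standard
   density with the density of variance 2. *)
Lemma integral_gauss_sqr_lty : (\int[gauss R]_x (x ^+ 2)%:E < +oo)%E.
Proof.
have ms : measurable_fun setT (fun x : R => (x ^+ 2)%:E).
  by apply/measurable_EFinP; exact: measurable_funX.
rewrite ge0_integral_gauss//; last by move=> x; rewrite lee_fin sqr_ge0.
set s := Num.sqrt (2 : R).
have s0 : s != 0 by rewrite gt_eqF// sqrtr_gt0.
pose k := 4 * (normal_peak 1 / normal_peak s).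
have mpdf : measurable_fun setT (fun x : R => (normal_pdf 0 s x)%:E).
  by apply/measurable_EFinP; exact: measurable_normal_pdf.
have k0 : 0 <= k by rewrite mulr_ge0// divr_ge0// normal_peak_ge0.
apply: (@le_lt_trans _ _ (\int[leb R]_x (k%:E * (normal_pdf 0 s x)%:E))%E).
  apply: ge0_le_integral => //.
  - by move=> x _; rewrite mule_ge0// lee_fin ?sqr_ge0// normal_pdf_ge0.
  - apply: emeasurable_funM => //.
    by apply/measurable_EFinP; exact: measurable_normal_pdf.
  - by apply: emeasurable_funM => //.
  move=> x _; rewrite -!EFinM lee_fin !normal_pdfE ?oner_neq0//.
  rewrite /normal_fun !subr0 sqr_sqrtr ?ler0n// expr1n.
  set t := x ^+ 2 / 4; have t0 : 0 <= t by rewrite divr_ge0// sqr_ge0.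
  have -> : - x ^+ 2 / (2 *+ 2) = - t by rewrite /t; field.
  have -> : - x ^+ 2 / (1 *+ 2) = - t + - t by rewrite /t; field.
  have -> : x ^+ 2 = 4 * t by rewrite /t; field.
  rewrite expRD.
  have -> : 4 * t * (normal_peak 1 * (expR (- t) * expR (- t))) =
    (4 * normal_peak 1 * expR (- t)) * (t * expR (- t)) by ring.
  have -> : k * (normal_peak s * expR (- t)) = 4 * normal_peak 1 * expR (- t).
    by rewrite /k; field; rewrite gt_eqF// normal_peak_gt0.
  apply: ler_piMr; first by rewrite !mulr_ge0 ?normal_peak_ge0 ?expR_ge0.
  rewrite -ler_pdivlMr ?expR_gt0// expRN invrK mul1r.
  by apply: le_trans (expR_ge1Dx t); rewrite lerDr.
rewrite ge0_integralZl//; last by move=> x _; rewrite lee_fin normal_pdf_ge0.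
rewrite ge0_integral_leb//; last by move=> x; rewrite lee_fin normal_pdf_ge0.
by rewrite integral_normal_pdf mule1 ltry.
Qed.

Lemma powR_le1D (t p q : R) : 0 <= t -> 0 <= p <= q -> t `^ p <= 1 + t `^ q.
Proof.
move=> t0 /andP[p0 pq]; have [t1|t1] := leP t 1.
  apply: (@le_trans _ _ 1); last by rewrite lerDl powR_ge0.
  have <- : 1 `^ p = 1 by rewrite powR1.
  by rewrite ge0_ler_powR// nnegrE.
apply: (@le_trans _ _ (t `^ q)); last by rewrite lerDr.
by apply: ler_powR => //; exact: ltW.
Qed.

Lemma measurable_normr_powR (p : R) :
  measurable_fun setT (fun x : R => `|x| `^ p).
Proof. exact: (measurableT_comp (@measurable_powR R p)). Qed.

Lemma integral_gauss_powR_lty (p : R) : 0 <= p <= 2 ->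
  (\int[gauss R]_x (`|x| `^ p)%:E < +oo)%E.
Proof.
move=> p02; apply: (@le_lt_trans _ _ (\int[gauss R]_x (1 + (x ^+ 2)%:E))%E).
  apply: ge0_le_integral => //.
  - by apply/measurable_EFinP; exact: measurable_normr_powR.
  - apply: emeasurable_funD => //.
    by apply/measurable_EFinP; exact: measurable_funX.
  - move=> x _; rewrite -EFinD lee_fin.
    by rewrite -real_normK ?num_real// -powR_mulrn// powR_le1D.
rewrite ge0_integralD//; first last.
- by apply/measurable_EFinP; exact: measurable_funX.
- by move=> x _; rewrite lee_fin sqr_ge0.
rewrite integral_cst// mul1e lte_add_pinfty//.
- by rewrite [X in (X < _)%E]probability_setT ltry.
- exact: integral_gauss_sqr_lty.
Qed.

(** A real integral is [fine] of an extended one and would hide an infinite value; for [p] in this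
    range the second moment gives finiteness. *)
Lemma gaussian_abs_momentE (p : R) : 0 <= p <= 2 ->
  (gaussian_abs_moment p)%:E = (\int[gauss R]_x (`|x| `^ p)%:E)%E.
Proof.
move=> p02; have mp : measurable_fun setT (fun x : R => (`|x| `^ p)%:E).
  by apply/measurable_EFinP; exact: measurable_normr_powR.
have p0 (x : R) : (0 <= (`|x| `^ p)%:E)%E by rewrite lee_fin powR_ge0.
have -> : gaussian_abs_moment p = fine (\int[gauss R]_x (`|x| `^ p)%:E)%E.
  rewrite ge0_integral_gauss// ge0_integral_leb; first by [].
  - by apply: emeasurable_funM => //; apply/measurable_EFinP; exact: measurable_normal_pdf.
  - by move=> x; rewrite mule_ge0// lee_fin normal_pdf_ge0.
rewrite fineK// ge0_fin_numE; first exact: integral_gauss_powR_lty.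
by apply: integral_ge0 => x _; exact: p0.
Qed.

Lemma integral_gauss_dist_powR (a : R) : 0 < a <= 1 ->
  (\int[gauss R]_x \int[gauss R]_y (`|x - y| `^ (2 * a))%:E =
   (2 `^ a * gaussian_abs_moment (2 * a))%:E)%E.
Proof.
move=> /andP[a0 a1].
have p02 : 0 <= 2 * a <= 2 by apply/andP; split; lra.
set s := Num.sqrt (2 : R).
have s0 : 0 < s by rewrite sqrtr_gt0.
have s2 : s ^+ 2 = 2 by rewrite sqr_sqrtr.
pose H (z : R * R) := (`|s * z.2| `^ (2 * a))%:E.
have mH : measurable_fun setT H.
  apply/measurable_EFinP; apply: (measurableT_comp (measurable_normr_powR _)).
  exact: measurable_funM.
have H0 z : (0 <= H z)%E by rewrite lee_fin powR_ge0.
(* Rotation by 45 degrees: [(y - x) / sqrt 2] is again standard Gaussian, and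
   [(sqrt 2) ^ (2 a) = 2 ^ a]. *)
have cs : s^-1 ^+ 2 + s^-1 ^+ 2 = 1 by rewrite exprVn s2; field.
have := gaussian_rotation (invr_neq0 (lt0r_neq0 s0)) cs mH H0.
under eq_integral do under eq_integral do
  rewrite /H /= -mulrBr mulrA mulfV ?gt_eqF// mul1r distrC.
move=> ->.
have HE : (\int[gauss R]_y (`|s * y| `^ (2 * a))%:E =
    (2 `^ a * gaussian_abs_moment (2 * a))%:E)%E.
  under eq_integral do rewrite normrM powRM// EFinM.
  rewrite ge0_integralZl//; first last.
  - by apply/measurable_EFinP; exact: measurable_normr_powR.
  - by rewrite -gaussian_abs_momentE// -EFinM gtr0_norm// powRrM powR_mulrn ?ltW// s2.
transitivity (\int[gauss R]_x cst (2 `^ a * gaussian_abs_moment (2 * a))%:E x)%E.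
  by apply: eq_integral => x _; exact: HE.
rewrite integral_cst//.
by rewrite [X in (_ * X)%E]probability_setT mule1.
Qed.

End gaussian_moments.

(** * Mean and variance of a square-integrable function *)

Section square_integrable.
Context d (T : measurableType d) (R : realType) (P : probability T R).
Implicit Types phi : T -> R.

Lemma sqr_integrable phi : measurable_fun setT phi ->
  (\int[P]_x (phi x ^+ 2)%:E < +oo)%E ->
  P.-integrable setT (EFin \o (fun x => phi x ^+ 2)).
Proof.
move=> mphi phi2; apply/integrableP; split.
  by apply/measurable_EFinP; exact: measurable_funX.
by under eq_integral do rewrite /= ger0_norm ?sqr_ge0//.
Qed.

Lemma integrable_of_sqr phi : measurable_fun setT phi ->
  (\int[P]_x (phi x ^+ 2)%:E < +oo)%E -> P.-integrable setT (EFin \o phi).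
Proof.
move=> mphi phi2.
apply: (@le_integrable _ _ _ _ _ _ _ (EFin \o (fun x => 1 + phi x ^+ 2))) => //.
- exact/measurable_EFinP.
- move=> x _ /=; rewrite lee_fin [leRHS]ger0_norm ?addr_ge0 ?sqr_ge0//.
  have := sqr_ge0 (`|phi x| - 1); rewrite -(real_normK (num_real (phi x))); nra.
have ic : P.-integrable setT (EFin \o cst 1) by exact: finite_measure_integrable_cst.
exact: (integrableD measurableT ic (sqr_integrable mphi phi2)).
Qed.

(** The centre [a] is arbitrary because two values matter: [a = 0] gives Pythagoras for [avg] and
    [res], and [a = phi x] gives [double_variance]. *)
Lemma integral_sqrB phi (a : R) : measurable_fun setT phi ->
  (\int[P]_x (phi x ^+ 2)%:E < +oo)%E ->
  (\int[P]_x ((phi x - a) ^+ 2)%:E =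
   \int[P]_x ((phi x - \int[P]_y phi y)%R ^+ 2)%:E +
   ((\int[P]_y phi y - a)%R ^+ 2)%:E)%E.
Proof.
move=> mphi phi2.
have i1 := integrable_of_sqr mphi phi2; have i2 := sqr_integrable mphi phi2.
set m := (\int[P]_y phi y)%R; set I2 := (\int[P]_y (phi y ^+ 2))%R.
have E b : (\int[P]_x ((phi x - b) ^+ 2)%:E = (I2 - 2 * b * m + b ^+ 2)%:E)%E.
  have ic : P.-integrable setT (EFin \o cst (b ^+ 2)).
    exact: finite_measure_integrable_cst.
  have i1' : P.-integrable setT (EFin \o (fun x => 2 * b * phi x)).
    exact: (@integrableZl _ _ _ _ _ _ (2 * b) (EFin \o phi)).
  have i3 : P.-integrable setT (EFin \o (fun x => phi x ^+ 2 - 2 * b * phi x)).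
    exact: (integrableB _ i2 i1').
  have ES x : (phi x - b) ^+ 2 = phi x ^+ 2 - 2 * b * phi x + b ^+ 2 by ring.
  under eq_integral do rewrite ES.
  rewrite -(@fineK _ (\int[P]_x _)%E).
    congr EFin; rewrite -/(Rintegral P setT _) RintegralD// RintegralB// RintegralZl//.
    by rewrite Rintegral_cst// [X in fine X]probability_setT mulr1.
  by apply: integrable_fin_num => //; exact: (integrableD measurableT i3 ic).
by rewrite !E -EFinD; congr EFin; ring.
Qed.

(** A Hoelder condition controls differences of values rather than deviations from a mean; a second
    independent copy converts one into the other without loss. It is [integral_sqrB] integrated over
    its centre. *)
Lemma double_variance phi : measurable_fun setT phi ->
  (\int[P]_x (phi x ^+ 2)%:E < +oo)%E ->
  (\int[P]_x \int[P]_y ((phi x - phi y) ^+ 2)%:E =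
   2%:E * \int[P]_x ((phi x - \int[P]_y phi y)%R ^+ 2)%:E)%E.
Proof.
move=> mphi phi2; set m := (\int[P]_y phi y)%R.
set V := (\int[P]_x ((phi x - m) ^+ 2)%:E)%E.
have ms : measurable_fun setT (fun x => ((phi x - m) ^+ 2)%:E).
  by apply/measurable_EFinP; apply: measurable_funX; exact: measurable_funB.
have s0 x : (0 <= ((phi x - m) ^+ 2)%:E)%E by rewrite lee_fin sqr_ge0.
transitivity (\int[P]_x (V + ((phi x - m) ^+ 2)%:E))%E.
  apply: eq_integral => x _.
  transitivity (\int[P]_y ((phi y - phi x) ^+ 2)%:E)%E.
    by apply: eq_integral => y _; rewrite -sqrrN opprB.
  by rewrite integral_sqrB// -/m -/V -(sqrrN (m - phi x)) opprB.
rewrite ge0_integralD//; last by move=> x _; exact: integral_ge0.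
by rewrite integral_cst// [X in (V * X)%E]probability_setT mule1 -/V -mule2n mule_natl.
Qed.

End square_integrable.

(** * Functions of a vector, one coordinate at a time *)

Section vectors.
Variables (R : realType) (n : nat).
Implicit Types (x y : 'cV[R]_n) (j : 'I_n) (z : R).

Definition upd x j z : 'cV[R]_n := \col_i (if i == j then z else x i 0).

Lemma upd_idem x j z t : upd (upd x j z) j t = upd x j t.
Proof. by apply/colP => i; rewrite !mxE; case: eqP. Qed.

Lemma upd_id x j : upd x j (x j 0) = x.
Proof. by apply/colP => i; rewrite !mxE; case: eqP => // ->. Qed.

(* Column vectors carry no measurable structure here: measurability is tested by
   substituting measurable coordinates. *)
Definition vec_measurable d' (U : measurableType d') (h : 'cV[R]_n -> U) :=
  forall d (S : measurableType d) (Y : 'I_n -> S -> R),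
    (forall i, measurable_fun setT (Y i)) ->
    measurable_fun setT (fun s => h (\col_i Y i s)).

Lemma vec_measurable_comp d1 d2 (U1 : measurableType d1)
    (U2 : measurableType d2) (g : U1 -> U2) (h : 'cV[R]_n -> U1) :
  measurable_fun setT g -> vec_measurable h -> vec_measurable (g \o h).
Proof. by move=> mg mh d S Y mY; apply: measurableT_comp => //; exact: mh. Qed.

Lemma vec_measurable_upd d' (U : measurableType d') (h : 'cV[R]_n -> U)
    d (S : measurableType d) (Y : 'I_n -> S -> R) (Z : S -> R) j :
  vec_measurable h ->
  (forall i, i != j -> measurable_fun setT (Y i)) -> measurable_fun setT Z ->
  measurable_fun setT (fun s => h (upd (\col_i Y i s) j (Z s))).
Proof.
move=> mh mY mZ; rewrite (_ : (fun _ => _) =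
    fun s => h (\col_i (if i == j then Z else Y i) s)).
  by apply: mh => i; case: eqP => // /eqP; exact: mY.
by apply/funext => s; congr h; apply/colP => i; rewrite !mxE; case: eqP.
Qed.

Lemma vec_measurable_section d' (U : measurableType d') (h : 'cV[R]_n -> U) x j :
  vec_measurable h -> measurable_fun setT (fun z => h (upd x j z)).
Proof.
move=> mh; rewrite (_ : (fun _ => _) =
  fun z => h (\col_i (if i == j then z else x i 0))); last by [].
by apply: (mh _ R (fun i z => if i == j then z else x i 0)) => i; case: eqP.
Qed.

Section holder.
Variable alpha : R.
Hypothesis alpha01 : 0 < alpha <= 1.

Let alpha_neq0 : alpha != 0. Proof. by case/andP: alpha01 => /gt_eqF ->. Qed.

(** Replaces the power [alpha] of the Euclidean distance: overwriting one coordinate of both vectors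
    changes a single term, so averages over a coordinate are easily compared. *)
Definition hdist x y := \sum_i `|x i 0 - y i 0| `^ alpha.

Definition holder (f : 'cV[R]_n -> R) :=
  exists2 K, 0 <= K & forall x y, `|f x - f y| <= K * hdist x y.

Lemma hdist_ge0 x y : 0 <= hdist x y.
Proof. by apply: sumr_ge0 => i _; exact: powR_ge0. Qed.

Lemma hdistC x y : hdist x y = hdist y x.
Proof. by apply: eq_bigr => i _; rewrite distrC. Qed.

Lemma hdist_upd x y j z : hdist (upd x j z) (upd y j z) <= hdist x y.
Proof.
apply: ler_sum => i _; rewrite !mxE; case: eqP => // _.
by rewrite subrr normr0 powR0// powR_ge0.
Qed.

Lemma hdist_upd1 x j z t : hdist (upd x j z) (upd x j t) = `|z - t| `^ alpha.
Proof.
rewrite /hdist (bigD1 j)//= !mxE eqxx big1 ?addr0// => i ij.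
by rewrite !mxE (negbTE ij) subrr normr0 powR0.
Qed.

Lemma holderB f g : holder f -> holder g -> holder (fun x => f x - g x).
Proof.
move=> [K K0 hf] [L L0 hg]; exists (K + L); first exact: addr_ge0.
move=> x y; rewrite mulrDl (_ : f x - g x - _ = (f x - f y) - (g x - g y)); last by ring.
by rewrite (le_trans (ler_normB _ _))// lerD.
Qed.

Lemma hdist_dense x (e : R) : 0 < e ->
  exists q : 'cV[rat]_n, hdist x (\col_i ratr (q i 0)) < e.
Proof.
move=> e0; have /andP[a0 a1] := alpha01.
(* With [n.+1] instead of [n], the sum of [n] terms stays strictly below [e], also for [n = 0]. *)
pose b := e / n.+1%:R.
have b0 : 0 < b by rewrite divr_gt0.
pose c := b `^ alpha^-1.
have c0 : 0 < c by rewrite powR_gt0.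
have cE : c `^ alpha = b by rewrite /c -powRrM mulVf ?gt_eqF// powRr1// ltW.
have ex i : exists q : rat, `|x i 0 - ratr q| < c.
  have /rat_in_itvoo[q] : x i 0 - c < x i 0 + c by lra.
  rewrite in_itv/= => /andP[h1 h2]; exists q.
  by rewrite ltr_norml; lra.
pose q := \col_i xchoose (ex i).
exists q; apply: (@le_lt_trans _ _ (\sum_(i < n) b)).
  apply: ler_sum => i _; rewrite !mxE -cE.
  have qi := ltW (xchooseP (ex i)).
  apply: (ge0_ler_powR (ltW a0) _ _ qi); rewrite nnegrE; [exact: normr_ge0|exact: ltW].
by rewrite sumr_const card_ord -mulr_natl /b mulrA ltr_pdivrMr// mulrC ltr_pM2l// ltr_nat.
Qed.

(* [f < a] at a vector iff [f q + K * hdist _ q < a] for some rational [q]. *)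
Lemma holder_measurable f : holder f -> vec_measurable f.
Proof.
move=> [K K0 hf] d S Y mY _.
have mdist (q : 'cV[rat]_n) : measurable_fun setT
    (fun s => hdist (\col_i Y i s) (\col_i ratr (q i 0))).
  apply: measurable_sum => i.
  under eq_fun do rewrite !mxE.
  apply: (measurableT_comp (@measurable_normr_powR R alpha)).
  exact: measurable_funB.
apply: (measurability _ (RGenInftyO.measurableE R)) => //.
move=> _ [_ [a ->] <-]; rewrite setTI.
rewrite (_ : _ @^-1` _ = \bigcup_(q : 'cV[rat]_n)
   [set s | f (\col_i ratr (q i 0)) + K * hdist (\col_i Y i s) (\col_i ratr (q i 0)) < a]).
  apply: countable_bigcupT_measurable; first exact: countableP.
  move=> q; rewrite -[X in measurable X]setTI.
  have := @measurable_funD _ S R setT (cst (f (\col_i ratr (q i 0))))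
    (fun s => K * hdist (\col_i Y i s) (\col_i ratr (q i 0))).
  move=> /(_ (measurable_cst _) (measurable_funM (measurable_cst _) (mdist q))).
  move=> /(_ measurableT `]-oo, a[%classic (measurable_itv _)).
  congr (measurable _); apply/seteqP; split => s /=; rewrite in_itv/=; tauto.
apply/seteqP; split => s /=; rewrite in_itv/=.
  move=> fa; pose e := a - f (\col_i Y i s).
  have e0 : 0 < e by rewrite subr_gt0.
  (* The amount [K * hdist] is paid twice, once to compare the two values of [f] and once in the set
     itself, hence the 2; [K + 1] covers [K = 0]. *)
  have e1 : 0 < e / (2 * (K + 1)) by rewrite divr_gt0//; lra.
  have [q qe] := hdist_dense (\col_i Y i s) e1.
  exists q => //=.
  have := hf (\col_i ratr (q i 0)) (\col_i Y i s); rewrite hdistC ler_norml => /andP[_].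
  move: qe; rewrite ltr_pdivlMr; last by lra.
  have := hdist_ge0 (\col_i Y i s) (\col_i ratr (q i 0)).
  move: (hdist _ _) (f (\col_i ratr _)) => D F; rewrite /e; nra.
move=> [q _] /=; apply: le_lt_trans.
have := hf (\col_i Y i s) (\col_i ratr (q i 0)); rewrite ler_norml; lra.
Qed.

End holder.
End vectors.

(** * Averaging over one coordinate *)

Section averages.
Variables (R : realType) (n : nat) (alpha : R).
Hypothesis alpha01 : 0 < alpha <= 1.
Implicit Types (x y : 'cV[R]_n) (j : 'I_n) (f g : 'cV[R]_n -> R).
Local Notation holder := (@holder R n alpha).

Definition avg j f x : R := (\int[gauss R]_z f (upd x j z))%R.

Definition res j f x : R := f x - avg j f x.

Lemma measurable_section f x j : holder f ->
  measurable_fun setT (fun z => f (upd x j z)).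
Proof. by move=> hf; apply: vec_measurable_section; exact: (holder_measurable alpha01). Qed.

Lemma sqr_section_lty f x j : holder f ->
  (\int[gauss R]_z (f (upd x j z) ^+ 2)%:E < +oo)%E.
Proof.
move=> hf; have mf := measurable_section x j hf.
have [K K0 fK] := hf; have /andP[a0 a1] := alpha01.
(* Linear growth along the section: [|z|^alpha <= 1 + |z|] gives [|f| <= c + K |z|], whose square is
   at most [2 c^2 + 2 K^2 z^2]. *)
pose c := `|f (upd x j 0)| + K.
have c0 : 0 <= c by rewrite addr_ge0.
have msqr (h : R -> R) : measurable_fun setT h ->
    measurable_fun setT (fun z => (h z ^+ 2)%:E).
  by move=> mh; apply/measurable_EFinP; exact: measurable_funX.
have sqr0 (h : R -> R) z : (0 <= (h z ^+ 2)%:E)%E by rewrite lee_fin sqr_ge0.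
have mz : measurable_fun setT (fun z : R => (2 * K ^+ 2)%:E * (z ^+ 2)%:E)%E.
  by apply: emeasurable_funM => //; exact: msqr.
have K20 : (0 <= (2 * K ^+ 2)%:E)%E by rewrite lee_fin mulr_ge0// sqr_ge0.
have c20 : (0 <= (2 * c ^+ 2)%:E)%E by rewrite lee_fin mulr_ge0// sqr_ge0.
have Kz0 (z : R) : (0 <= (2 * K ^+ 2)%:E * (z ^+ 2)%:E)%E.
  by rewrite mule_ge0// (sqr0 id).
apply: (@le_lt_trans _ _
  (\int[gauss R]_z ((2 * c ^+ 2)%:E + (2 * K ^+ 2)%:E * (z ^+ 2)%:E))%E).
  apply: ge0_le_integral; [exact: measurableT| |exact: msqr| |].
  - by move=> z _; exact: (sqr0 (fun z => f (upd x j z))).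
  - exact: emeasurable_funD.
  move=> z _; rewrite -EFinM -EFinD lee_fin.
  have h1 : `|f (upd x j z)| <= c + K * `|z|.
    have := fK (upd x j z) (upd x j 0); rewrite hdist_upd1// subr0 => h.
    have := lerB_dist (f (upd x j z)) (f (upd x j 0)).
    have := @powR_le1D R `|z| alpha 1 (normr_ge0 _).
    rewrite (ltW a0) a1 powRr1// => /(_ isT) h2.
    have := ler_wpM2l K0 h2; rewrite /c; lra.
  rewrite -(real_normK (num_real (f _))) -(real_normK (num_real z)).
  have := normr_ge0 (f (upd x j z)); have := normr_ge0 z.
  move: h1; move: `|f _| `|z| => F Z h1 Z0 F0.
  have : F ^+ 2 <= (c + K * Z) ^+ 2 by rewrite ler_sqr ?nnegrE// addr_ge0// mulr_ge0.
  have := sqr_ge0 (c - K * Z); nra.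
rewrite ge0_integralD// integral_cst// ge0_integralZl//; last first.
- by move=> z _; exact: (sqr0 id).
- exact: msqr.
rewrite [X in ((_ * X) + _)%E]probability_setT mule1 lte_add_pinfty ?ltry//.
by rewrite lte_mul_pinfty// integral_gauss_sqr_lty.
Qed.

Lemma integrable_section f x j : holder f ->
  (gauss R).-integrable setT (EFin \o (fun z => f (upd x j z))).
Proof.
by move=> hf; apply: integrable_of_sqr; [exact: measurable_section|exact: sqr_section_lty].
Qed.

Lemma avg_upd j f x z : avg j f (upd x j z) = avg j f x.
Proof. by apply: eq_Rintegral => t _; rewrite upd_idem. Qed.

Lemma avgB j f g x : holder f -> holder g ->
  avg j (fun y => f y - g y) x = avg j f x - avg j g x.
Proof. by move=> hf hg; rewrite /avg RintegralB//; exact: integrable_section. Qed.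

(** The constant [K] is inherited, since giving both vectors the same [j]-th coordinate only removes
    a term of [hdist]. *)
Lemma holder_avg j f : holder f -> holder (avg j f).
Proof.
move=> hf; have [K K0 fK] := hf; exists K => // x y.
have ix := integrable_section x j hf; have iy := integrable_section y j hf.
have id : (gauss R).-integrable setT
    (EFin \o (fun z => f (upd x j z) - f (upd y j z))).
  exact: (integrableB measurableT ix iy).
rewrite /avg -RintegralB//; apply: le_trans (le_normr_Rintegral measurableT id) _.
apply: (@le_trans _ _ (\int[gauss R]_z (K * hdist alpha x y))%R).
  apply: le_Rintegral => //.
  - exact: (integrable_abse id).
  - exact: (@finite_measure_integrable_cst _ _ _ (gauss R) setT (K * hdist alpha x y)).
  - move=> z _; apply: le_trans (fK _ _) _.
    by rewrite ler_wpM2l// hdist_upd.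
by rewrite Rintegral_cst// [X in fine X]probability_setT mulr1.
Qed.

Lemma holder_res j f : holder f -> holder (res j f).
Proof. by move=> hf; apply: holderB => //; exact: holder_avg. Qed.

Lemma pythagoras_section j f x : holder f ->
  (\int[gauss R]_z (f (upd x j z) ^+ 2)%:E =
   (avg j f x ^+ 2)%:E + \int[gauss R]_z (res j f (upd x j z) ^+ 2)%:E)%E.
Proof.
move=> hf.
have := integral_sqrB 0 (measurable_section x j hf) (sqr_section_lty x j hf).
under eq_integral do rewrite subr0.
move=> ->; rewrite subr0 addeC; congr (_ + _)%E.
by apply: eq_integral => z _; rewrite /res avg_upd.
Qed.

Lemma variance_section j f x (C : R) : holder f ->
  (forall z t, `|f (upd x j z) - f (upd x j t)| <= C * `|z - t| `^ alpha) ->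
  (\int[gauss R]_z (res j f (upd x j z) ^+ 2)%:E <=
   (C ^+ 2 * 2 `^ (alpha - 1) * gaussian_abs_moment (2 * alpha))%:E)%E.
Proof.
move=> hf fC; have mf := measurable_section x j hf.
pose D (z : R * R) := (`|z.1 - z.2| `^ (2 * alpha))%:E.
pose F (z : R * R) := ((f (upd x j z.1) - f (upd x j z.2)) ^+ 2)%:E.
have mD : measurable_fun setT D.
  apply/measurable_EFinP; apply: (measurableT_comp (@measurable_normr_powR R _)).
  exact: measurable_funB.
have mF : measurable_fun setT F.
  apply/measurable_EFinP; apply: measurable_funX; apply: measurable_funB.
    exact: (measurableT_comp mf).
  exact: (measurableT_comp mf).
have D0 z : (0 <= D z)%E by rewrite lee_fin powR_ge0.
have F0 z : (0 <= F z)%E by rewrite lee_fin sqr_ge0.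
have C20 : (0 <= (C ^+ 2)%:E)%E by rewrite lee_fin sqr_ge0.
have mDx z : measurable_fun setT (fun t => D (z, t)) by exact: measurableT_comp.
have mFx z : measurable_fun setT (fun t => F (z, t)) by exact: measurableT_comp.
have mID := measurable_fun_fubini_tonelli_F (m2 := gauss R) D mD D0.
have mIF := measurable_fun_fubini_tonelli_F (m2 := gauss R) F mF F0.
have FD z t : (F (z, t) <= (C ^+ 2)%:E * D (z, t))%E.
  rewrite -EFinM lee_fin/= mulrC powRrM powRAC powR_mulrn ?powR_ge0// mulrC.
  rewrite -exprMn -(real_normK (num_real (f _ - f _))).
  have fzt := fC z t.
  by rewrite ler_sqr// nnegrE// (le_trans _ fzt).
have two : (\int[gauss R]_z \int[gauss R]_t F (z, t) <=
    (C ^+ 2)%:E * \int[gauss R]_z \int[gauss R]_t D (z, t))%E.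
  rewrite -ge0_integralZl//; last by move=> z _; exact: integral_ge0.
  apply: ge0_le_integral; [exact: measurableT| |exact: mIF| |].
  - by move=> z _; exact: integral_ge0.
  - exact: emeasurable_funM.
  move=> z _; rewrite -ge0_integralZl//.
  apply: ge0_le_integral; [exact: measurableT| |exact: mFx| |].
  - by move=> t _; exact: F0.
  - exact: emeasurable_funM.
  - by move=> t _; exact: FD.
move: two; rewrite integral_gauss_dist_powR//.
have := double_variance mf (sqr_section_lty x j hf).
rewrite -/(avg j f x).
have -> : (\int[gauss R]_z (res j f (upd x j z) ^+ 2)%:E =
    \int[gauss R]_z ((f (upd x j z) - avg j f x)%R ^+ 2)%:E)%E.
  by apply: eq_integral => z _; rewrite /res avg_upd.
move=> -> two.
rewrite -(@lee_pmul2l _ 2%:E)//; apply: le_trans two _.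
rewrite -!EFinM lee_fin.
(* The 2 of [double_variance] is cancelled against the [2 ^ alpha] of [integral_gauss_dist_powR]. *)
have -> : 2 `^ alpha = 2 * 2 `^ (alpha - 1) :> R.
  rewrite -{2}[2](@powRr1 R 2)// -powRD ?pnatr_eq0 ?implybT//.
  by congr (_ `^ _); ring.
by rewrite le_eqVlt; apply/orP; left; apply/eqP; ring.
Qed.

End averages.

(** * Freezing the other coordinates *)

Section independence.
Context disp (T : measurableType disp) (R : realType) (P : probability T R).
Variables (d : nat) (X : 'I_d -> {RV P >-> R}).
Hypothesis hX : standard_gaussian P X.
Implicit Types (u : {set 'I_d}) (j : 'I_d).

Lemma prob_coordinate j (B : set R) : measurable B -> P (X j @^-1` B) = gauss R B.
Proof. by move=> mB; exact: (hX.2 j B mB). Qed.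

Lemma measurable_RV j (B : set R) : measurable B -> measurable (X j @^-1` B).
Proof. by move=> mB; rewrite -[_ @^-1` _]setTI; exact: (measurable_funP (X j)). Qed.

(** A pi-system generating the sigma-algebra of [x_u], in the form to which the product rule of
    [independent_components] applies. *)
Definition boxes u : set (set T) :=
  [set A | exists B : 'I_d -> set R, [/\ forall i, measurable (B i),
     forall i, i \notin u -> B i = setT &
     A = [set w | forall i, B i (X i w)]]].

Lemma boxes_setI u : setI_closed (boxes u).
Proof.
move=> _ _ [B1 [m1 t1 ->]] [B2 [m2 t2 ->]].
exists (fun i => B1 i `&` B2 i); split.
- by move=> i; exact: measurableI.
- by move=> i iu; rewrite t1// t2// setIT.
- by apply/seteqP; split => w /=; [move=> [h1 h2] i; split|move=> h; split => i; case: (h i)].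
Qed.

Lemma boxes_setT u : boxes u setT.
Proof. by exists (fun=> setT); split => //; apply/seteqP; split. Qed.

Lemma boxes_measurable u : boxes u `<=` measurable.
Proof.
move=> _ [B [mB _ ->]]; rewrite (_ : [set w | _] = \bigcap_(i in setT) (X i @^-1` B i)).
  by apply: fin_bigcap_measurable => // i _; exact: measurable_RV.
by apply/seteqP; split => w /= h i; [move=> _|]; exact: h.
Qed.

Lemma coordinate_events_boxes u : coordinate_events P X u `<=` boxes u.
Proof.
move=> A [i /= iu [C mC <-]]; rewrite setTI.
exists (fun k => if k == i then C else setT); split.
- by move=> k; case: eqP.
- by move=> k; case: eqP => // -> /negP.
- apply/seteqP; split => w /=; first by move=> Xi k; case: eqP => // ->.
  by move=> /(_ i); rewrite eqxx.
Qed.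

Lemma coordinate_events_measurable u :
  <<s coordinate_events P X u >> `<=` measurable.
Proof.
apply: smallest_sub; first exact: sigma_algebra_measurable.
exact: subset_trans (@coordinate_events_boxes u) (@boxes_measurable u).
Qed.

(** For fixed [B] both sides are finite measures in [A]; they agree on boxes, whose [j]-th slot is
    free to receive [B], hence on the generated sigma-algebra. *)
Lemma coordinate_independent u j A (B : set R) : j \notin u ->
  <<s coordinate_events P X u >> A -> measurable B ->
  P (A `&` X j @^-1` B) = (P A * gauss R B)%E.
Proof.
move=> ju sA mB; have mXB := measurable_RV j mB.
have gB0 : 0 <= fine (gauss R B) by rewrite fine_ge0.
have gBE : ((fine (gauss R B))%:E = gauss R B)%E.
  by rewrite fineK// fin_num_measure.
rewrite muleC -gBE.
apply: (@g_sigma_algebra_measure_unique _ R T (boxes u) (@boxes_measurable u)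
   (fun=> setT) (fun=> boxes_setT u) _ (mrestr P mXB) (mscale (NngNum gB0) P)).
- by rewrite bigcup_const//; exists 0%N.
- exact: boxes_setI.
- move=> _ [C [mC tC ->]]; rewrite /= /mrestr /mscale/= gBE.
  pose C' i := if i == j then B else C i.
  rewrite (_ : _ `&` _ = [set w | forall i, C' i (X i w)]); last first.
    apply/seteqP; split => w /=.
      by move=> [h1 h2] i; rewrite /C'; case: eqP => [->|].
    move=> h; split; last by have := h j; rewrite /C' eqxx.
    move=> i; have := h i; rewrite /C'; case: eqP => // -> _.
    by rewrite tC.
  rewrite !hX.1// => [|i]; last by rewrite /C'; case: eqP.
  rewrite (bigD1 j)//= [in RHS](bigD1 j)//= tC//.
  rewrite [X in (_ * (X * _))%E]probability_setT mul1e.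
  rewrite {1}/C' eqxx -(prob_coordinate j mB); congr (_ * _)%E.
  by apply: eq_bigr => i ij; rewrite /C' (negbTE ij).
- by move=> k; rewrite /= /mrestr setTI (le_lt_trans (probability_le1 _ _))// ltry.
- move: A sA; apply: smallest_sub; first exact: smallest_sigma_algebra.
  by move=> A /coordinate_events_boxes; exact: sub_sigma_algebra.
Qed.

Lemma measurable_coordinate u i : i \in u ->
  measurable_fun setT (X i : g_sigma_algebraType (coordinate_events P X u) -> R).
Proof.
move=> iu _ B mB; apply: sub_sigma_algebra.
by exists i => //; exists B.
Qed.

Lemma measurable_of_coordinates u d' (U : measurableType d')
    (h : g_sigma_algebraType (coordinate_events P X u) -> U) :
  measurable_fun setT h -> measurable_fun setT (h : T -> U).
Proof.
by move=> mh _ B mB; apply: (@coordinate_events_measurable u); exact: mh.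
Qed.

(** Through this identity map, the restriction of [P] to the sigma-algebra of [x_u] becomes a
    distribution on a space of its own. *)
Lemma measurable_to_coordinates u :
  measurable_fun setT (id : T -> g_sigma_algebraType (coordinate_events P X u)).
Proof. by move=> _ A mA; rewrite setTI; exact: (@coordinate_events_measurable u). Qed.

Lemma sub_coordinate_events u (v : {set 'I_d}) : u \subset v ->
  <<s coordinate_events P X u >> `<=` <<s coordinate_events P X v >>.
Proof.
move=> uv; apply: smallest_sub; first exact: smallest_sigma_algebra.
move=> A [i /= iu [C mC <-]]; apply: sub_sigma_algebra.
by exists i; [exact: (fintype.subsetP uv)|exists C].
Qed.

(** By [coordinate_independent], the joint law of [w], seen through [x_u] only, and of [X j w] is a
    product measure; Tonelli does the rest. *)
Lemma ge0_integral_fresh u j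
    (K : g_sigma_algebraType (coordinate_events P X u) * R -> \bar R) :
  j \notin u -> measurable_fun setT K -> (forall p, 0 <= K p)%E ->
  (\int[P]_w K (w, X j w) = \int[P]_w \int[gauss R]_z K (w, z))%E.
Proof.
move=> ju mK K0.
pose S := g_sigma_algebraType (coordinate_events P X u).
have mid := @measurable_to_coordinates u.
have mpair : measurable_fun setT (fun w : T => (w : S, X j w)).
  by apply/measurable_fun_pairP; split; [exact: mid|exact: measurable_funP].
pose idS : {mfun T >-> S} := mfun_Sub (mem_set mid).
pose pairS : {mfun T >-> (S * R)%type} := mfun_Sub (mem_set mpair).
transitivity (\int[distribution P pairS]_p K p)%E.
  by rewrite ge0_integral_distribution.
transitivity (\int[(distribution P idS \x gauss R)%E]_p K p)%E.
  apply: eq_measure_integral => A mA _; apply/esym.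
  apply: product_measure_unique => // B C mB mC.
  exact: (coordinate_independent ju mB mC).
rewrite fubini_tonelli1//.
rewrite ge0_integral_distribution//; first exact: measurable_fun_fubini_tonelli_F.
by move=> w; exact: integral_ge0.
Qed.

Lemma ge0_integral_coordinate u j (h : 'cV[R]_d -> \bar R) (A : set T) :
  j \notin u -> <<s coordinate_events P X u >> A -> vec_measurable h ->
  (forall x, 0 <= h x)%E ->
  (\int[P]_(w in A) h (random_vector P X w) =
   \int[P]_(w in A) \int[gauss R]_z h (upd (random_vector P X w) j z))%E.
Proof.
move=> ju sA mh h0.
(* [h] reads all coordinates, so [u] is enlarged to everything but [j]; the event [A] stays
   measurable there. *)
pose u' := [set~ j]%SET.
have uu' : u \subset u'.
  by apply/fintype.subsetP => i iu; rewrite !inE; apply: contraNneq ju => <-.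
have ju' : j \notin u' by rewrite !inE eqxx.
have {}sA := sub_coordinate_events uu' sA.
have mA := coordinate_events_measurable sA.
pose S := g_sigma_algebraType (coordinate_events P X u').
pose K (p : S * R) := (h (upd (random_vector P X p.1) j p.2) * (\1_A p.1)%:E)%E.
have mK : measurable_fun setT K.
  apply: emeasurable_funM.
    apply: (vec_measurable_upd (Y := fun i (p : S * R) => X i p.1) (Z := snd)) => //.
    move=> i ij; apply: (measurableT_comp (f := (X i : S -> R)) _ measurable_fst).
    by apply: measurable_coordinate; rewrite !inE.
  apply/measurable_EFinP; apply: (measurableT_comp (f := (\1_A : S -> R)) _ measurable_fst).
  exact: measurable_indic.
have K0 p : (0 <= K p)%E by rewrite mule_ge0// lee_fin.
rewrite integral_mkcond [RHS]integral_mkcond !epatch_indic.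
transitivity (\int[P]_w K (w, X j w))%E.
  apply: eq_integral => w _; rewrite /K /=; congr (h _ * _)%E.
  by rewrite -[LHS](upd_id _ j) mxE.
apply: (etrans (ge0_integral_fresh ju' mK K0)); apply: eq_integral => w _.
by rewrite /K/= -ge0_integralZr//; exact: vec_measurable_section.
Qed.

End independence.

(** * Iterated averages and ANOVA components *)

Section subset_sums.
Variables (A : Type) (idx : A) (op : Monoid.com_law idx) (I : finType).
Implicit Types (j : I) (v w : {set I}) (F : {set I} -> A).

Lemma big_subset_setU1_in j w F : j \notin w ->
  \big[op/idx]_(v : {set I} | (v \subset j |: w)%SET && (j \in v)) F v =
  \big[op/idx]_(v : {set I} | v \subset w) F (j |: v)%SET.
Proof.
move=> jw.
rewrite (reindex_onto (fun v => (j |: v)%SET) (fun v => (v :\ j)%SET))/=; last first.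
  by move=> v /andP[_ jv]; rewrite finset.setD1K.
apply: eq_bigl => v; rewrite finset.setU11 andbT.
have [vw|vw] := boolP (v \subset w).
  have jv : j \notin v by apply: contra jw; exact: (fintype.subsetP vw).
  by rewrite finset.setU1K// eqxx andbT finset.setUS.
apply/negbTE; rewrite negb_and; have [jv|jv] := boolP (j \in v).
  apply/orP; right; apply: contraL jv => /eqP <-.
  by rewrite !inE eqxx.
apply/orP; left; apply: contra vw => /fintype.subsetP sub.
apply/fintype.subsetP => i iv; have := sub i.
rewrite !inE iv orbT => /(_ isT) /orP[/eqP ij|//].
by rewrite -ij iv in jv.
Qed.

Lemma big_subset_setU1 j w F : j \notin w ->
  \big[op/idx]_(v : {set I} | v \subset (j |: w)%SET) F v =
  \big[op/idx]_(v : {set I} | v \subset w) op (F v) (F (j |: v)%SET).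
Proof.
move=> jw; rewrite (bigID (fun v : {set I} => j \in v))/= big_subset_setU1_in//.
rewrite Monoid.mulmC big_split/=; congr (op _ _); apply: eq_bigl => v.
apply/andP/idP => [[/fintype.subsetP sub jv]|vw].
  apply/fintype.subsetP => i iv; have := sub i iv.
  by rewrite !inE => /orP[/eqP ij|//]; rewrite -ij iv in jv.
split; last by apply: contra jw; exact: (fintype.subsetP vw).
exact: fintype.subset_trans vw (finset.subsetUr _ _).
Qed.

End subset_sums.

Section components.
Variables (R : realType) (d : nat) (alpha : R).
Hypothesis alpha01 : 0 < alpha <= 1.
Implicit Types (s : seq 'I_d) (u v : {set 'I_d}) (f h : 'cV[R]_d -> R).
Local Notation holder := (@holder R d alpha).

(* Iterated over an enumeration [s] of the coordinates, [proj] averages out those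
   outside [u]; [component] moreover subtracts the average over those in [u]. *)
Fixpoint proj s u h :=
  if s is j :: s' then proj s' u (if j \in u then h else avg j h) else h.

Fixpoint component s u h :=
  if s is j :: s' then component s' u (if j \in u then res j h else avg j h) else h.

Lemma holder_proj s u h : holder h -> holder (proj s u h).
Proof.
elim: s h => //= j s IH h hh; apply: IH; case: ifP => // _.
exact: holder_avg.
Qed.

Lemma holder_component s u h : holder h -> holder (component s u h).
Proof.
elim: s h => //= j s IH h hh; apply: IH; case: ifP => _.
  exact: holder_res.
exact: holder_avg.
Qed.

Lemma projB s u f h : holder f -> holder h ->
  proj s u (fun x => f x - h x) = fun x => proj s u f x - proj s u h x.
Proof.
elim: s f h => //= j s IH f h hf hh; case: ifP => _; first exact: IH.
rewrite -IH; [|exact: holder_avg..].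
by congr proj; apply/funext => x; rewrite (avgB alpha01).
Qed.

Lemma component_setU1 j s v h : j \notin s -> component s (j |: v)%SET h = component s v h.
Proof.
elim: s h => //= i s IH h; rewrite inE negb_or => /andP[ji js].
by rewrite IH// !inE eq_sym (negbTE ji).
Qed.

(** For each coordinate of [u] the sum offers both [avg] and [res], which add up to the identity;
    outside [u] only [avg] is left, and this is [proj]. Indices that are not in [s] are never
    tested. *)
Lemma sum_component s u h x : holder h -> uniq s ->
  \sum_(v : {set 'I_d} | v \subset u :&: [set i in s]) component s v h x = proj s u h x.
Proof.
elim: s h => /= [|j s IH] h hh; first move=> _.
  rewrite (big_pred1 finset.set0)// => v.
  rewrite (_ : (u :&: _)%SET = finset.set0) ?finset.subset0//.
  by apply/finset.setP => i; rewrite !inE andbF.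
move=> /andP[js us]; have [ju|ju] := boolP (j \in u).
  rewrite (_ : (u :&: _)%SET = (j |: (u :&: [set i in s]))%SET); last first.
    by apply/finset.setP => i; rewrite !inE; have [->|_] := eqVneq i j; rewrite ?ju.
  rewrite big_subset_setU1 ?inE ?negb_and ?js ?orbT//.
  have hr := holder_res alpha01 j hh; have ha := holder_avg alpha01 j hh.
  have -> : proj s u h x = proj s u (avg j h) x + proj s u (res j h) x.
    rewrite [X in _ + X](_ : _ = proj s u h x - proj s u (avg j h) x); first by ring.
    by rewrite /res projB.
  rewrite -!IH// -big_split/=; apply: eq_bigr => v /fintype.subsetP vs.
  have jv : j \notin v by apply: contra js => /vs; rewrite !inE => /andP[].
  by rewrite (negbTE jv) finset.setU11 component_setU1.
rewrite -IH//; last exact: holder_avg.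
rewrite (_ : (u :&: _)%SET = (u :&: [set i in s])%SET); last first.
  by apply/finset.setP => i; rewrite !inE; have [->|_] := eqVneq i j; rewrite ?(negbTE ju).
apply: eq_bigr => v /fintype.subsetP vs.
by rewrite ifN//; apply: contra ju => /vs; rewrite !inE => /andP[].
Qed.

Definition depends_on (p : pred 'I_d) h :=
  forall x y : 'cV[R]_d, (forall i, p i -> x i 0 = y i 0) -> h x = h y.

Lemma depends_on_proj s u h :
  depends_on [pred i | (i \in u) || (i \in s)] h -> depends_on [in u] (proj s u h).
Proof.
elim: s h => /= [|j s IH] h dh.
  by move=> x y xy; apply: dh => i /=; rewrite orbF; exact: xy.
apply: IH; case: ifPn => ju x y xy.
  by apply: dh => i /=; rewrite inE; case: eqP => [-> _|_]; apply: xy => //=; rewrite ju.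
apply: eq_Rintegral => z _; apply: dh => i /=; rewrite !mxE inE.
by case: eqP => //= _; exact: xy.
Qed.

End components.

(** The linear form of [e] covers both uses: overwriting a coordinate by [z], and shifting by
    [z *: a]. *)
Lemma vec_measurable_integral (R : realType) n (h : 'cV[R]_n -> \bar R)
    (e : 'cV[R]_n -> R -> 'cV[R]_n) :
  (forall i, exists (k : 'I_n -> R) (c : R),
    forall x z, e x z i 0 = \sum_l k l * x l 0 + c * z) ->
  vec_measurable h -> (forall x, 0 <= h x)%E ->
  vec_measurable (fun x => \int[gauss R]_z h (e x z))%E.
Proof.
move=> he mh h0 d S Y mY.
apply: (measurable_fun_fubini_tonelli_F (m2 := gauss R)
  (fun p : S * R => h (e (\col_i Y i p.1) p.2))); last by move=> p.
rewrite (_ : (fun _ => _) = fun p => h (\col_i e (\col_i Y i p.1) p.2 i 0)); last first.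
  by apply/funext => p; congr h; apply/colP => i; rewrite !mxE.
apply: (mh _ _ (fun i (p : S * R) => e (\col_i Y i p.1) p.2 i 0)) => i.
have [k [c ee]] := he i.
rewrite (_ : (fun _ => _) = fun p : S * R => \sum_l k l * Y l p.1 + c * p.2); last first.
  by apply/funext => p; rewrite ee; congr (_ + _); apply: eq_bigr => l _; rewrite !mxE.
apply: measurable_funD; last exact: measurable_funM.
apply: measurable_sum => l; apply: measurable_funM => //.
exact: (measurableT_comp (mY l)).
Qed.

Lemma vec_measurable_integral_upd (R : realType) n (h : 'cV[R]_n -> \bar R) j :
  vec_measurable h -> (forall x, 0 <= h x)%E ->
  vec_measurable (fun x => \int[gauss R]_z h (upd x j z))%E.
Proof.
apply: vec_measurable_integral => i.
exists (fun l => if (i == j) || (l != i) then 0 else 1).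
exists (if i == j then 1 else 0) => x z; rewrite !mxE.
case: eqP => /= _.
  by rewrite big1 ?add0r ?mul1r// => l _; rewrite mul0r.
rewrite mul0r addr0 (bigD1 i)//= eqxx mul1r big1 ?addr0// => l li.
by rewrite li mul0r.
Qed.

Section second_moments.
Context disp (T : measurableType disp) (R : realType) (P : probability T R).
Variables (d : nat) (X : 'I_d -> {RV P >-> R}) (alpha : R).
Hypothesis hX : standard_gaussian P X.
Hypothesis alpha01 : 0 < alpha <= 1.
Implicit Types (s : seq 'I_d) (u v : {set 'I_d}) (f h : 'cV[R]_d -> R) (j : 'I_d).
Local Notation holder := (@holder R d alpha).
Local Notation rv := (random_vector P X).
Local Notation sigma u := (<<s coordinate_events P X u >>).

Lemma measurable_rv d' (U : measurableType d') (h : 'cV[R]_d -> U) :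
  vec_measurable h -> measurable_fun setT (fun w => h (rv w)).
Proof. by move=> mh; apply: mh. Qed.

Lemma measurable_holder_rv h : holder h -> measurable_fun setT (fun w => h (rv w)).
Proof. by move=> hh; apply: measurable_rv; exact: (holder_measurable alpha01). Qed.

Lemma vec_measurable_sqr h : holder h -> vec_measurable (fun x => (h x ^+ 2)%:E).
Proof.
move=> hh; apply: (vec_measurable_comp (g := fun t : R => (t ^+ 2)%:E)).
  by apply/measurable_EFinP; exact: measurable_funX.
exact: (holder_measurable alpha01).
Qed.

Lemma measurable_sqr_rv h : holder h -> measurable_fun setT (fun w => (h (rv w) ^+ 2)%:E).
Proof. by move=> hh; exact: (measurable_rv (vec_measurable_sqr hh)). Qed.

Lemma setT_sigma u : sigma u setT.
Proof. exact: (@measurableT _ (g_sigma_algebraType (coordinate_events P X u))). Qed.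

Lemma integral_sqr_coordinate j h : holder h ->
  (\int[P]_w (h (rv w) ^+ 2)%:E =
   \int[P]_w \int[gauss R]_z (h (upd (rv w) j z) ^+ 2)%:E)%E.
Proof.
move=> hh.
apply: (@ge0_integral_coordinate _ _ _ _ _ _ hX finset.set0 j (fun x => (h x ^+ 2)%:E)).
- by rewrite inE.
- exact: setT_sigma.
- exact: vec_measurable_sqr.
- by move=> x; rewrite lee_fin sqr_ge0.
Qed.

Lemma pythagoras j h : holder h ->
  (\int[P]_w (h (rv w) ^+ 2)%:E =
   \int[P]_w (avg j h (rv w) ^+ 2)%:E + \int[P]_w (res j h (rv w) ^+ 2)%:E)%E.
Proof.
move=> hh; have ha := holder_avg alpha01 j hh; have hr := holder_res alpha01 j hh.
rewrite (integral_sqr_coordinate j hh) (integral_sqr_coordinate j hr).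
rewrite -ge0_integralD//.
- by apply: eq_integral => w _; rewrite (pythagoras_section alpha01).
- by move=> w _; rewrite lee_fin sqr_ge0.
- exact: (measurable_sqr_rv ha).
- by move=> w _; apply: integral_ge0 => z _; rewrite lee_fin sqr_ge0.
- apply: (measurable_rv (h := fun x => \int[gauss R]_z (res j h (upd x j z) ^+ 2)%:E)%E).
  apply: (vec_measurable_integral_upd j (vec_measurable_sqr hr)).
  by move=> x; rewrite lee_fin sqr_ge0.
Qed.

Lemma integral_res_sqr_le j h (C : R) : holder h ->
  (forall x z t, `|h (upd x j z) - h (upd x j t)| <= C * `|z - t| `^ alpha) ->
  (\int[P]_w (res j h (rv w) ^+ 2)%:E <=
   (C ^+ 2 * 2 `^ (alpha - 1) * gaussian_abs_moment (2 * alpha))%:E)%E.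
Proof.
move=> hh hC; have hr := holder_res alpha01 j hh.
rewrite (integral_sqr_coordinate j hr).
set B := (_ * _ * _).
have -> : B%:E = (\int[P]_w (cst B%:E w))%E.
  by rewrite integral_cst// [X in (_ * X)%E]probability_setT mule1.
apply: ge0_le_integral => //.
- by move=> w _; apply: integral_ge0 => z _; rewrite lee_fin sqr_ge0.
- apply: (measurable_rv (h := fun x => \int[gauss R]_z (res j h (upd x j z) ^+ 2)%:E)%E).
  apply: (vec_measurable_integral_upd j (vec_measurable_sqr hr)).
  by move=> x; rewrite lee_fin sqr_ge0.
- by move=> w _; apply: (variance_section alpha01).
Qed.

End second_moments.

(** * Conditional expectations *)

Section conditional_expectations.
Context disp (T : measurableType disp) (R : realType) (P : probability T R).
Variables (d : nat) (X : 'I_d -> {RV P >-> R}) (alpha : R).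
Hypothesis hX : standard_gaussian P X.
Hypothesis alpha01 : 0 < alpha <= 1.
Implicit Types (s : seq 'I_d) (u v : {set 'I_d}) (f h : 'cV[R]_d -> R) (j : 'I_d).
Local Notation holder := (@holder R d alpha).
Local Notation rv := (random_vector P X).
Local Notation sigma u := (<<s coordinate_events P X u >>).

(** Orthogonality enters one coordinate at a time, through [pythagoras]; no inner product of two
    components is computed. *)
Lemma pythagoras_component s h : holder h -> uniq s ->
  (\int[P]_w (h (rv w) ^+ 2)%:E =
   \sum_(v : {set 'I_d} | v \subset [set i in s]%SET)
     \int[P]_w (component s v h (rv w) ^+ 2)%:E)%E.
Proof.
elim: s h => /= [|j s IH] h hh.
  move=> _; rewrite (big_pred1 finset.set0)// => v.
  rewrite (_ : [set i in [::]]%SET = finset.set0 :> {set 'I_d}) ?finset.subset0//.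
move=> /andP[js us].
have hr := holder_res alpha01 j hh; have ha := holder_avg alpha01 j hh.
rewrite (pythagoras hX alpha01 j hh) (IH _ ha us) (IH _ hr us).
rewrite (_ : [set i in j :: s]%SET = (j |: [set i in s])%SET); last first.
  by apply/finset.setP => i; rewrite !inE.
rewrite big_subset_setU1 ?inE// -big_split/=; apply: eq_bigr => v vs.
have jv : j \notin v by apply: contra js => /(fintype.subsetP vs); rewrite inE.
by rewrite (negbTE jv) finset.setU11 component_setU1.
Qed.

(** Each residual has a second moment bounded by a constant, and averaging out every coordinate
    leaves a constant function; finitely many applications of [pythagoras] add these up. *)
Lemma holder_sqr_lty h : holder h -> (\int[P]_w (h (rv w) ^+ 2)%:E < +oo)%E.
Proof.
move=> hh; have K s k : holder k ->
    (\int[P]_w (proj s finset.set0 k (rv w) ^+ 2)%:E < +oo)%E ->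
    (\int[P]_w (k (rv w) ^+ 2)%:E < +oo)%E.
  elim: s k => //= j s IH k hk; rewrite inE => kfin.
  rewrite (pythagoras hX alpha01 j hk) lte_add_pinfty//.
    by apply: IH => //; exact: holder_avg.
  have [K K0 kK] := hk.
  apply: le_lt_trans (integral_res_sqr_le hX alpha01 (j := j) (C := K) hk _) (ltry _).
  by move=> x z t; rewrite -(hdist_upd1 alpha01 x j).
apply: (K (enum 'I_d)) => //.
have dp : depends_on [in finset.set0] (proj (enum 'I_d) finset.set0 h).
  apply: depends_on_proj => x y xy; congr h; apply/colP => i; apply: xy.
  by rewrite /= mem_enum orbT.
rewrite (eq_integral (cst (proj (enum 'I_d) finset.set0 h 0 ^+ 2)%:E)); last first.
  by move=> w _; rewrite (dp (rv w) 0)// => i; rewrite /= inE.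
by rewrite integral_cst// [X in (_ * X)%E]probability_setT mule1 ltry.
Qed.

Lemma holder_integrable h : holder h -> P.-integrable setT (EFin \o (fun w => h (rv w))).
Proof.
move=> hh; apply: integrable_of_sqr; last exact: holder_sqr_lty.
exact: (measurable_holder_rv X alpha01 hh).
Qed.

(** Tonelli treats the positive and negative parts of [h]; their integrals are finite, so the two
    identities can be subtracted. *)
Lemma integral_avg u j h A : j \notin u -> sigma u A -> holder h ->
  (\int[P]_(w in A) (h (rv w))%:E = \int[P]_(w in A) (avg j h (rv w))%:E)%E.
Proof.
move=> ju sA hh; have mA := coordinate_events_measurable sA.
have mh := holder_measurable alpha01 hh.
have ih := holder_integrable hh.
pose hp x := Num.max (h x) 0; pose hn x := Num.max (- h x) 0.
have mhp : vec_measurable (fun x => (hp x)%:E).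
  apply: (vec_measurable_comp (g := fun t : R => (Num.max t 0)%:E)) => //.
  by apply/measurable_EFinP; exact: measurable_maxr.
have mhn : vec_measurable (fun x => (hn x)%:E).
  apply: (vec_measurable_comp (g := fun t : R => (Num.max (- t) 0)%:E)) => //.
  by apply/measurable_EFinP; apply: measurable_maxr => //; exact: measurable_funN.
have hp0 x : (0 <= (hp x)%:E)%E by rewrite lee_fin le_max lexx orbT.
have hn0 x : (0 <= (hn x)%:E)%E by rewrite lee_fin le_max lexx orbT.
have Ep := ge0_integral_coordinate hX ju sA mhp hp0.
have En := ge0_integral_coordinate hX ju sA mhn hn0.
pose Ip x := (\int[gauss R]_z (hp (upd x j z))%:E)%E.
pose In x := (\int[gauss R]_z (hn (upd x j z))%:E)%E.
have avgE x : ((avg j h x)%:E = Ip x - In x)%E.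
  have isec := integrable_section alpha01 x j hh.
  rewrite /avg /Rintegral fineK; last exact: integrable_fin_num.
  by rewrite integralE; congr (_ - _)%E; apply: eq_integral => z _;
    rewrite ?funeposE ?funenegE /= /hp /hn EFin_max ?EFinN.
have hE : (\int[P]_(w in A) (h (rv w))%:E =
    \int[P]_(w in A) (hp (rv w))%:E - \int[P]_(w in A) (hn (rv w))%:E)%E.
  by rewrite integralE; congr (_ - _)%E; apply: eq_integral => w _;
    rewrite ?funeposE ?funenegE /= /hp /hn EFin_max ?EFinN.
have ihA : P.-integrable A (EFin \o (fun w => h (rv w))).
  exact: integrableS ih.
have fin_p : (\int[P]_(w in A) (hp (rv w))%:E < +oo)%E.
  have := integrable_funepos mA ihA => /integrableP[_]; apply: le_lt_trans.
  rewrite le_eqVlt; apply/orP; left; apply/eqP; apply: eq_integral => w _.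
  by rewrite gee0_abs ?funepos_ge0// funeposE /hp EFin_max.
have fin_n : (\int[P]_(w in A) (hn (rv w))%:E < +oo)%E.
  have := integrable_funeneg mA ihA => /integrableP[_]; apply: le_lt_trans.
  rewrite le_eqVlt; apply/orP; left; apply/eqP; apply: eq_integral => w _.
  by rewrite gee0_abs ?funeneg_ge0// funenegE /hn EFin_max.
have iI (k : 'cV[R]_d -> \bar R) : vec_measurable k -> (forall x, 0 <= k x)%E ->
    (\int[P]_(w in A) k (rv w) < +oo)%E ->
    P.-integrable A (fun w => \int[gauss R]_z k (upd (rv w) j z))%E.
  move=> mk k0 kfin; apply/integrableP; split.
    apply: measurable_funTS.
    exact: (measurable_rv X (vec_measurable_integral_upd j mk k0)).
  under eq_integral do rewrite gee0_abs ?integral_ge0//.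
  by rewrite -(ge0_integral_coordinate hX ju sA mk k0).
rewrite hE Ep En -integralB//; [|exact: (iI _ mhp)|exact: (iI _ mhn)].
by apply: eq_integral => w _; rewrite avgE.
Qed.

Lemma integral_proj s u h A : sigma u A -> holder h ->
  (\int[P]_(w in A) (h (rv w))%:E = \int[P]_(w in A) (proj s u h (rv w))%:E)%E.
Proof.
move=> sA; elim: s h => //= j s IH h hh; case: ifPn => ju; first exact: IH.
by rewrite (integral_avg ju sA hh) IH//; exact: holder_avg.
Qed.

Lemma proj_is_cond_expectation s u h : (forall i, i \in s) -> holder h ->
  is_cond_expectation P (coordinate_events P X u) (h \o rv)
    (proj s u h \o rv).
Proof.
move=> hs hh; have hp := holder_proj alpha01 s u hh; split.
- have dp : depends_on [in u] (proj s u h).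
    apply: depends_on_proj => x y xy; congr h; apply/colP => i; apply: xy.
    by rewrite /= hs orbT.
  (* The coordinates outside [u] do not affect [proj]; set to 0, they leave only functions
     measurable for the sigma-algebra of [x_u]. *)
  rewrite (_ : _ \o _ = fun w => proj s u h
      (\col_i (if i \in u then X i else cst 0) w)).
    apply: (holder_measurable alpha01 hp) => i; case: ifPn => iu //.
    exact: measurable_coordinate.
  by apply/funext => w; apply: dp => i /= iu; rewrite !mxE iu.
- exact: holder_integrable.
- by move=> A sA; rewrite -(integral_proj _ sA hh).
Qed.

(** Integrals are compared only over events of the sigma-algebra of [x_u], so almost sure uniqueness
    is applied on that coarser space and its null set is carried back. *)
Lemma cond_expectation_unique u (F h1 h2 : T -> R) :
  is_cond_expectation P (coordinate_events P X u) F h1 ->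
  is_cond_expectation P (coordinate_events P X u) F h2 ->
  {ae P, forall w, h1 w = h2 w}.
Proof.
move=> [m1 i1 e1] [m2 i2 e2].
have mid := @measurable_to_coordinates _ _ _ _ _ X u.
pose S := g_sigma_algebraType (coordinate_events P X u).
pose idS : {mfun T >-> S} := mfun_Sub (mem_set mid).
have [] : ae_eq (distribution P idS) setT (EFin \o (h1 : S -> R)) (EFin \o (h2 : S -> R)).
  have M1 : measurable_fun setT (EFin \o (h1 : S -> R)) by exact/measurable_EFinP.
  have M2 : measurable_fun setT (EFin \o (h2 : S -> R)) by exact/measurable_EFinP.
  apply: integral_ae_eq; [exact: measurableT| |exact: M2|].
    exact: (integrable_pushforward mid M1 i1 measurableT).
  move=> A _ mA; have mA' := coordinate_events_measurable mA.
  have i1A : P.-integrable A (EFin \o h1) by exact: integrableS i1.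
  have i2A : P.-integrable A (EFin \o h2) by exact: integrableS i2.
  apply: (etrans (integral_pushforward mid M1 i1A mA)).
  apply: (etrans _ (esym (integral_pushforward mid M2 i2A mA))).
  exact: etrans (e1 A mA) (esym (e2 A mA)).
move=> N [mN PN0 sub]; exists N; split => //.
  exact: (coordinate_events_measurable mN).
by move=> w /= h12; apply: sub => /= /(_ I) [].
Qed.

End conditional_expectations.

(** * Variances of the ANOVA components *)

Section anova_components.
Context disp (T : measurableType disp) (R : realType) (P : probability T R).
Variables (d : nat) (X : 'I_d -> {RV P >-> R}) (alpha : R).
Hypothesis hX : standard_gaussian P X.
Hypothesis alpha01 : 0 < alpha <= 1.
Variable f : 'cV[R]_d -> R.
Hypothesis hf : holder alpha f.
Implicit Types (s : seq 'I_d) (u v : {set 'I_d}) (j : 'I_d).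
Local Notation rv := (random_vector P X).

(** The iterated average is a version, so [xget] does not fall back on its default. *)
Lemma cond_expectation_holderP u :
  is_cond_expectation P (coordinate_events P X u) (f \o rv)
    (cond_expectation P (coordinate_events P X u) (f \o rv)).
Proof.
apply: (xgetPex (cst 0)); exists (proj (enum 'I_d) u f \o rv).
by apply: (proj_is_cond_expectation hX alpha01) => // i; rewrite mem_enum.
Qed.

Lemma measurable_anova u : measurable_fun setT (anova P X f u).
Proof.
suff H n : forall v, measurable_fun setT (anova_rec X f n v) by exact: H.
elim: n => [|n IH] v //=; apply: measurable_funB.
  by case: (cond_expectation_holderP v) => m _ _; exact: (measurable_of_coordinates m).
rewrite [X in measurable_fun _ X](_ : _ = fun w =>
    \sum_(t : {set 'I_d}) (if t \proper v then anova_rec X f n t w else 0)); last first.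
  by apply/funext => w; rewrite big_mkcond.
pose g (t : {set 'I_d}) w := if t \proper v then anova_rec X f n t w else 0.
by apply: (measurable_sum _ (h := g)) => t; rewrite /g; case: (t \proper v).
Qed.

(* The enumeration [s] is arbitrary: the components depend on it only up to a null
   set, which is what allows [sum_anova_variance_in] to start with [j]. *)
Lemma anova_ae s u : (forall i, i \in s) -> uniq s ->
  {ae P, forall w, anova P X f u w = component s u f (rv w)}.
Proof.
move=> hs us; have [n un] := ubnP #|u|; elim: n => // n IH in u un *.
have h1 := proj_is_cond_expectation hX alpha01 u hs hf.
have A1 := cond_expectation_unique (cond_expectation_holderP u) h1.
(* There are finitely many proper subsets, so one null set serves for all of them. *)
have A2 : \forall w \ae P, forall v : {v : {set 'I_d} | v \proper u},
    anova P X f (val v) w = component s (val v) f (rv w).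
  apply: filter_forall => -[v /= vu]; apply: IH.
  by rewrite (leq_trans (proper_card vu))// -ltnS.
apply: filterS2 A1 A2 => w cE vE; rewrite anovaE cE /=.
(* The conditional expectation is now the sum of the components over all subsets of [u]; subtracting
   the proper ones leaves [component s u f]. *)
rewrite -(sum_component alpha01 u (rv w) hf us).
rewrite (_ : (u :&: _)%SET = u); last first.
  by apply/finset.setP => i; rewrite !inE hs andbT.
rewrite (bigD1 u)//= [X in _ - X](eq_bigr (fun v => component s v f (rv w))); last first.
  by move=> v vu; exact: (vE (exist _ v vu)).
rewrite [X in _ + X - _](eq_bigl (fun v : {set 'I_d} => v \proper u)) ?addrK// => v.
by rewrite finset.properEneq andbC.
Qed.

Lemma anova_sqr s u : (forall i, i \in s) -> uniq s ->
  (\int[P]_w (anova P X f u w ^+ 2)%:E = \int[P]_w (component s u f (rv w) ^+ 2)%:E)%E.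
Proof.
move=> hs us; apply: ge0_ae_eq_integral => //.
- by apply/measurable_EFinP; apply: measurable_funX; exact: measurable_anova.
- exact: (measurable_sqr_rv X alpha01 (holder_component alpha01 s u hf)).
- by move=> w _; rewrite lee_fin sqr_ge0.
- by move=> w _; rewrite lee_fin sqr_ge0.
by apply: filterS (anova_ae u hs us) => w -> .
Qed.

Lemma anova_sqr_fin u : (\int[P]_w (anova P X f u w ^+ 2)%:E)%E \is a fin_num.
Proof.
have hs i : i \in enum 'I_d by rewrite mem_enum.
rewrite (anova_sqr u hs (enum_uniq _)) ge0_fin_numE.
  exact: (holder_sqr_lty hX alpha01 (holder_component alpha01 _ u hf)).
by apply: integral_ge0 => w _; rewrite lee_fin sqr_ge0.
Qed.

Lemma anova_varianceE u : u != finset.set0 ->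
  (anova_variance P X f u)%:E = (\int[P]_w (anova P X f u w ^+ 2)%:E)%E.
Proof.
by move=> u0; rewrite /anova_variance (negbTE u0) unlock fineK// anova_sqr_fin.
Qed.

Lemma sum_anova_variance_in j :
  (\sum_(u : {set 'I_d} | j \in u) anova_variance P X f u)%:E =
  (\int[P]_w (res j f (rv w) ^+ 2)%:E)%E.
Proof.
(* Along [j :: s], the component of a set containing [j] is a component of [res j f] along [s], so
   Pythagoras for [res j f] gives the sum. *)
pose s := rem j (enum 'I_d).
have js : j \notin s by rewrite mem_rem_uniqF// enum_uniq.
have us : uniq s by rewrite rem_uniq// enum_uniq.
have hs i : i \in j :: s.
  by rewrite inE mem_rem_uniq ?enum_uniq// inE mem_enum andbT orbN.
have ujs : uniq (j :: s) by rewrite /= js.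
have hr := holder_res alpha01 j hf.
rewrite (pythagoras_component hX alpha01 hr us) -sumEFin.
transitivity (\sum_(u : {set 'I_d} | (u \subset j |: [set i in s])%SET && (j \in u))
    \int[P]_w (component (j :: s) u f (rv w) ^+ 2)%:E)%E.
  apply: eq_big => [u|u ju].
    rewrite (_ : (j |: _)%SET = finset.setT) ?finset.subsetT//.
    by apply/finset.setP => i; have := hs i; rewrite !inE.
  rewrite anova_varianceE ?(anova_sqr u hs)//.
  by apply: contraTneq ju => ->; rewrite inE.
rewrite big_subset_setU1_in ?inE//; apply: eq_bigr => v _.
by rewrite /= finset.setU11 component_setU1.
Qed.

End anova_components.

Section anova_total.
Context disp (T : measurableType disp) (R : realType) (P : probability T R).
Variables (d : nat) (X : 'I_d -> {RV P >-> R}) (alpha : R).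
Hypothesis hX : standard_gaussian P X.
Hypothesis alpha01 : 0 < alpha <= 1.
Variable f : 'cV[R]_d -> R.
Hypothesis hf : holder alpha f.
Implicit Types (s : seq 'I_d) (u v : {set 'I_d}) (j : 'I_d).
Local Notation rv := (random_vector P X).

Lemma varianceE_integral (F : T -> R) :
  ('V_P[F] = \int[P]_w ((F w - \int[P]_v F v)%R ^+ 2)%:E)%E.
Proof. by rewrite /variance covariance.unlock expectation.unlock. Qed.

Lemma component_set0 s (h : 'cV[R]_d -> R) :
  component s finset.set0 h = proj s finset.set0 h.
Proof. by elim: s h => //= j s IH h; rewrite inE IH. Qed.

Lemma proj_set0 s w : (forall i, i \in s) ->
  proj s finset.set0 f (rv w) = \int[P]_v f (rv v).
Proof.
move=> hs.
have dp : depends_on [in finset.set0] (proj s finset.set0 f).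
  apply: depends_on_proj => x y xy; congr f; apply/colP => i; apply: xy.
  by rewrite /= hs orbT.
rewrite /Rintegral (integral_proj hX alpha01 s (@setT_sigma _ _ _ _ _ X finset.set0) hf).
rewrite (eq_integral (cst (proj s finset.set0 f (rv w))%:E)); last first.
  by move=> v _; rewrite (dp (rv v) (rv w))// => i; rewrite /= inE.
by rewrite integral_cst// [X in (_ * X)%E]probability_setT mule1.
Qed.

(** Pythagoras over all coordinates and the decomposition around the mean are two expressions of
    [E f^2]. The empty set contributes the squared mean, which is subtracted; [anova_variance] sets
    that term to 0. *)
Lemma sum_anova_variance :
  (\sum_(u : {set 'I_d}) anova_variance P X f u)%:E = 'V_P[f \o rv]%E.
Proof.
rewrite varianceE_integral.
pose s := enum 'I_d.
have hs i : i \in s by rewrite mem_enum.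
have us : uniq s := enum_uniq _.
set m := \int[P]_v _.
have := integral_sqrB 0 (measurable_holder_rv X alpha01 hf) (holder_sqr_lty hX alpha01 hf).
rewrite subr0 -/m.
under eq_integral do rewrite subr0.
rewrite (pythagoras_component hX alpha01 hf us) (bigD1 finset.set0)/=; last first.
  exact: finset.sub0set.
have -> : (\int[P]_w (component s finset.set0 f (rv w) ^+ 2)%:E = (m ^+ 2)%:E)%E.
  rewrite (eq_integral (cst (m ^+ 2)%:E)); last first.
    by move=> w _; rewrite component_set0 proj_set0.
  by rewrite integral_cst// [X in (_ * X)%E]probability_setT mule1.
rewrite addeC => /(congr1 (fun t => t - (m ^+ 2)%:E)%E); rewrite !addeK// => <-.
rewrite (bigD1 finset.set0)//= {1}/anova_variance eqxx add0r -sumEFin.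
apply: eq_big => [u|u u0].
  rewrite (_ : (u \subset _) = true)//.
  by apply/fintype.subsetP => i _; rewrite inE hs.
by rewrite (anova_varianceE hX alpha01 hf)// (anova_sqr hX alpha01 hf u hs us).
Qed.

Lemma weighted_sum_anova_variance :
  \sum_(u : {set 'I_d}) #|u|%:R * anova_variance P X f u =
  \sum_j \sum_(u : {set 'I_d} | j \in u) anova_variance P X f u.
Proof.
rewrite (exchange_big_dep xpredT)//=; apply: eq_bigr => u _.
by rewrite sumr_const mulr_natl.
Qed.

(** Valid for every Hoelder function, with a separate constant for each coordinate; the ridge
    structure enters later, through the values of [L]. *)
Lemma mean_dimension_le (L : 'I_d -> R) :
  (forall j x z t, `|f (upd x j z) - f (upd x j t)| <= L j * `|z - t| `^ alpha) ->
  (0 < 'V_P[f \o rv])%E ->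
  mean_dimension P X f <=
    (\sum_j L j ^+ 2) * (2 `^ (alpha - 1) * gaussian_abs_moment (2 * alpha)) /
    fine 'V_P[f \o rv]%E.
Proof.
move=> hL V0; rewrite /mean_dimension weighted_sum_anova_variance.
rewrite -sum_anova_variance /= in V0 *.
rewrite ler_pM2r ?invr_gt0// mulr_suml; apply: ler_sum => j _.
rewrite -lee_fin (sum_anova_variance_in hX alpha01 hf) mulrA.
exact: (integral_res_sqr_le hX alpha01 hf (hL j)).
Qed.

End anova_total.

(** * Rotation invariance of Gaussian smoothing *)

Section gaussian_shifts.
Variables (R : realType) (r : nat).
Implicit Types (a b y : 'cV[R]_r) (h : 'cV[R]_r -> \bar R) (l : seq 'cV[R]_r).

Definition nnmeas h := vec_measurable h /\ (forall y, 0 <= h y)%E.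

(* Smoothing [h] along all the vectors [a] of a list gives the expectation of
   [h (y + \sum_a Z_a *: a)] for independent standard Gaussian [Z_a]. *)
Definition smooth a h y : \bar R := (\int[gauss R]_z h (y + z *: a)%R)%E.

Fixpoint smooths l h := if l is a :: l' then smooths l' (smooth a h) else h.

Lemma nnmeas_smooth a h : nnmeas h -> nnmeas (smooth a h).
Proof.
move=> [mh h0]; split; last by move=> y; exact: integral_ge0.
apply: vec_measurable_integral => // i.
exists (fun t => if t == i then 1 else 0), (a i 0) => x z; rewrite !mxE mulrC.
congr (_ + _); rewrite (bigD1 i)//= eqxx mul1r big1 ?addr0// => k ki.
by rewrite (negbTE ki) mul0r.
Qed.

Lemma smooth0 h : smooth 0 h = h.
Proof.
apply/funext => y; rewrite /smooth.
transitivity (\int[gauss R]_z (cst (h y) z))%E.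
  by apply: eq_integral => z _; rewrite scaler0 addr0.
by rewrite integral_cst// [X in (_ * X)%E]probability_setT mule1.
Qed.

Lemma measurable_plane h a b y : nnmeas h ->
  measurable_fun setT (fun z : R * R => h (y + z.1 *: a + z.2 *: b)).
Proof.
move=> [mh _]; rewrite (_ : (fun _ => _) = fun z : R * R =>
    h (\col_i (y i 0 + z.1 * a i 0 + z.2 * b i 0))); last first.
  by apply/funext => z; congr h; apply/colP => i; rewrite !mxE.
apply: (mh _ _ (fun i (z : R * R) => y i 0 + z.1 * a i 0 + z.2 * b i 0)) => i.
apply: measurable_funD; last exact: measurable_funM.
by apply: measurable_funD => //; exact: measurable_funM.
Qed.

Lemma smoothC a b h : nnmeas h -> smooth a (smooth b h) = smooth b (smooth a h).
Proof.
move=> hh; apply/funext => y.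
apply: (etrans (@fubini_tonelli _ _ _ _ _ (gauss R) (gauss R)
  (fun z : R * R => h (y + z.1 *: a + z.2 *: b)) (measurable_plane a b y hh) _)).
  by move=> z; exact: hh.2.
apply: eq_integral => z _; apply: eq_integral => t _ /=.
by rewrite addrAC.
Qed.

(** Rotating the two Gaussian coefficients amounts to applying the transposed rotation to the
    directions [a] and [b]. *)
Lemma smooth_rotation (c s : R) a b h : c != 0 -> c ^+ 2 + s ^+ 2 = 1 ->
  nnmeas h ->
  smooth a (smooth b h) = smooth (c *: a - s *: b) (smooth (s *: a + c *: b) h).
Proof.
move=> c0 cs hh; apply/funext => y.
pose H (z : R * R) := h (y + z.1 *: a + z.2 *: b).
have mH : measurable_fun setT H := measurable_plane a b y hh.
have H0 z : (0 <= H z)%E by exact: hh.2.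
apply: (etrans (esym (gaussian_rotation c0 cs mH H0))).
apply: eq_integral => z _; apply: eq_integral => t _; rewrite /H /=.
congr h; apply/colP => i; rewrite !mxE; ring.
Qed.

(** The covariance matrix of the Gaussian shift along [l], preserved by rotations; for the rows of
    [Theta] it is [Theta^T *m Theta]. *)
Definition gram l (i j : 'I_r) : R := \sum_(b <- l) b i 0 * b j 0.

Lemma gram_cons a l i j : gram (a :: l) i j = a i 0 * a j 0 + gram l i j.
Proof. by rewrite /gram big_cons. Qed.

(* Givens rotations collect the [k]-th coordinates of all the vectors in one. *)
Lemma smooths_pivot (k : 'I_r) l : exists a l',
  [/\ forall i j, gram (a :: l') i j = gram l i j,
      forall b, b \in l' -> b k 0 = 0, 0 <= a k 0 &
      forall h, nnmeas h -> smooths l h = smooths (a :: l') h].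
Proof.
elim: l => [|b l [a [l' [gE l'0 a0 sE]]]].
  exists 0, [::]; split => //; last by move=> h _ /=; rewrite smooth0.
    by move=> i j; rewrite gram_cons !mxE mul0r add0r.
  by rewrite mxE.
have [bk0|bk0] := eqVneq (b k 0) 0.
  exists a, (b :: l'); split => //.
  - by move=> i j; rewrite !gram_cons -gE gram_cons addrCA.
  - by move=> x; rewrite inE => /predU1P[->//|/l'0].
  - move=> h hh /=; rewrite sE; last exact: nnmeas_smooth.
    by rewrite /= smoothC.
pose p := Num.sqrt (a k 0 ^+ 2 + b k 0 ^+ 2).
have s0 : 0 < a k 0 ^+ 2 + b k 0 ^+ 2.
  by rewrite ltr_wpDl ?sqr_ge0// exprn_even_gt0.
have p0 : 0 < p by rewrite sqrtr_gt0.
have p2 : p ^+ 2 = a k 0 ^+ 2 + b k 0 ^+ 2 by rewrite sqr_sqrtr// ltW.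
(* This angle annihilates the [k]-th coordinate of [c *: a - s *: b] and makes that of the other
   vector equal to [p]. The case [b k 0 = 0], treated above, would give [c = 0], which
   [smooth_rotation] excludes. *)
pose c := b k 0 / p; pose s := a k 0 / p.
have cs : c ^+ 2 + s ^+ 2 = 1.
  by rewrite /c /s !exprMn -mulrDl exprVn p2 addrC divff// gt_eqF.
have c0 : c != 0 by rewrite mulf_neq0// invr_neq0// gt_eqF.
exists (s *: a + c *: b), ((c *: a - s *: b) :: l'); split.
- move=> i j; rewrite !gram_cons -gE gram_cons !mxE.
  have -> : (s * a i 0 + c * b i 0) * (s * a j 0 + c * b j 0) +
    ((c * a i 0 - s * b i 0) * (c * a j 0 - s * b j 0) + gram l' i j) =
    (c ^+ 2 + s ^+ 2) * (a i 0 * a j 0 + b i 0 * b j 0) + gram l' i j by ring.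
  by rewrite cs; ring.
- move=> x; rewrite inE => /predU1P[->|/l'0//].
  by rewrite !mxE /c /s; ring.
- rewrite !mxE /c /s.
  have -> : a k 0 / p * a k 0 + b k 0 / p * b k 0 = p ^+ 2 / p by rewrite p2; ring.
  by rewrite divr_ge0// ?sqr_ge0// ltW.
- move=> h hh /=; rewrite sE; last exact: nnmeas_smooth.
  by rewrite /= (smooth_rotation a b c0 cs hh).
Qed.

(** A centred Gaussian law is determined by its covariance, here a coordinate projection. Each pivot
    splits off one basis vector; once [K] is exhausted the diagonal of [gram] vanishes, so all
    remaining vectors are zero. *)
Lemma smooths_gram (K : seq 'I_r) l h : uniq K ->
  (forall i j, gram l i j = ((i == j) && (i \in K))%:R) -> nnmeas h ->
  smooths l h = smooths [seq delta_mx k 0 | k <- K] h.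
Proof.
elim: K l h => [|k K IH] l h.
  move=> _ gl hh; elim: l gl h hh => //= b l IH gl h hh.
  have sq x (i : 'I_r) : 0 <= gram x i i.
    by apply: sumr_ge0 => t _; rewrite -expr2 sqr_ge0.
  have bl i : b i 0 = 0 /\ gram l i i = 0.
    have := gl i i; rewrite in_nil andbF gram_cons -expr2 mulr0n => e.
    have := sq l i; have := sqr_ge0 (b i 0) => h1 h2.
    have e1 : b i 0 ^+ 2 = 0 by apply/eqP; rewrite eq_le h1 andbT; lra.
    by split; [apply/eqP; rewrite -sqrf_eq0 e1|lra].
  have -> : b = 0 by apply/colP => i; rewrite mxE; have [] := bl i.
  rewrite smooth0; apply: IH => // i j; rewrite andbF.
  have := gl i j; rewrite andbF gram_cons; have [-> _] := bl i.
  by rewrite mul0r add0r.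
move=> /= /andP[kK uK] gl hh.
have [a [l' [gE l'0 a0 sE]]] := smooths_pivot k l.
have gk i : gram l' k i = 0.
  by rewrite /gram big_seq big1// => b /l'0 ->; rewrite mul0r.
(* The matrix only gives [a k 0 ^+ 2 = 1]; the sign kept by [smooths_pivot] excludes -1. *)
have ak : a k 0 = 1.
  have := gE k k; rewrite gl gram_cons gk addr0 eqxx inE eqxx/= => /eqP.
  by rewrite -expr2 sqrf_eq1 => /orP[/eqP//|/eqP e]; move: a0; rewrite e ler0N1.
have aE : a = delta_mx k 0.
  apply/colP => i; rewrite !mxE eqxx andbT.
  by have := gE k i; rewrite gl gram_cons gk addr0 ak mul1r inE eqxx/= andbT eq_sym.
rewrite sE//= aE; apply: IH => //; last exact: nnmeas_smooth.
move=> i j; have [->|ik] := eqVneq i k; first by rewrite gk (negbTE kK) andbF.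
have := gE i j; rewrite gram_cons gl aE !mxE inE (negbTE ik) /=.
by rewrite mul0r add0r.
Qed.

End gaussian_shifts.

Section linear_image.
Context disp (T : measurableType disp) (R : realType) (P : probability T R).
Variables (d r : nat) (X : 'I_d -> {RV P >-> R}) (Theta : 'M[R]_(d, r)).
Hypothesis hX : standard_gaussian P X.
Local Notation rv := (random_vector P X).
Implicit Types (y : 'cV[R]_r) (h : 'cV[R]_r -> \bar R) (s : seq 'I_d).

Lemma trmx_mulE (x : 'cV[R]_d) :
  Theta^T *m x = \sum_(j <- enum 'I_d) x j 0 *: (row j Theta)^T.
Proof.
rewrite big_enum/=; apply/colP => i; rewrite !mxE summxE; apply: eq_bigr => j _.
by rewrite !mxE mulrC.
Qed.

Lemma integral_lincomb s y h : uniq s -> nnmeas h ->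
  (\int[P]_w h (y + \sum_(j <- s) X j w *: (row j Theta)^T)%R =
   smooths [seq (row j Theta)^T | j <- s] h y)%E.
Proof.
elim: s y h => /= [|j s IH] y h.
  move=> _ hh; transitivity (\int[P]_w (cst (h y) w))%E.
    by apply: eq_integral => w _; rewrite big_nil addr0.
  by rewrite integral_cst// [X in (_ * X)%E]probability_setT mule1.
move=> /andP[js us] hh; rewrite -IH//; last exact: nnmeas_smooth.
pose k (x : 'cV[R]_d) := h (y + \sum_(i <- j :: s) x i 0 *: (row i Theta)^T).
have mk : vec_measurable k.
  move=> d' S Y mY.
  rewrite (_ : (fun _ => _) = fun p => h (\col_l
    (y l 0 + \sum_(i <- j :: s) Y i p * Theta i l))); last first.
    apply/funext => p; congr h; apply/colP => l; rewrite !mxE summxE.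
    by congr (_ + _); apply: eq_bigr => i _; rewrite !mxE.
  apply: (hh.1 _ _ (fun l p => y l 0 + \sum_(i <- j :: s) Y i p * Theta i l)) => l.
  apply: measurable_funD => //.
  apply: (measurable_sum _ (h := fun i p => Y i p * Theta i l)) => i.
  exact: measurable_funM.
have k0 x : (0 <= k x)%E by exact: hh.2.
have j0 : j \notin (finset.set0 : {set 'I_d}) by rewrite inE.
have := ge0_integral_coordinate hX j0 (@setT_sigma _ _ _ _ _ X finset.set0) mk k0.
rewrite (_ : (\int[P]_w k (rv w))%E =
  (\int[P]_w h (y + \sum_(j <- j :: s) X j w *: (row j Theta)^T)%R)%E); last first.
  apply: eq_integral => w _; rewrite /k; congr (h (_ + _)%R).
  by apply: eq_bigr => i _; rewrite mxE.
move=> ->; apply: eq_integral => w _; apply: eq_integral => z _; rewrite /k.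
congr h; rewrite big_cons !mxE eqxx addrCA addrC; congr (_ + _ + _).
apply: eq_big_seq => i is_; rewrite !mxE ifN//.
by apply: contraNneq js => <-.
Qed.

(** The right-hand side involves neither [d], nor [Theta], nor the probability space: this is the
    invariance of the law of [Theta^T x]. *)
Lemma integral_orthonormal h : Theta^T *m Theta = 1%:M -> nnmeas h ->
  (\int[P]_w h (Theta^T *m rv w) =
   smooths [seq delta_mx k 0%R | k <- enum 'I_r] h 0%R)%E.
Proof.
move=> hTheta hh; rewrite -(smooths_gram (l := [seq (row j Theta)^T | j <- enum 'I_d])).
- rewrite -integral_lincomb ?enum_uniq//; apply: eq_integral => w _.
  by rewrite trmx_mulE add0r; congr h; apply: eq_bigr => j _; rewrite mxE.
- exact: enum_uniq.
- move=> i j; rewrite mem_enum andbT /gram big_map big_enum/=.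
  have := congr1 (fun M : 'M[R]_r => M i j) hTheta; rewrite !mxE => <-.
  by apply: eq_bigr => k _; rewrite !mxE.
- exact: hh.
Qed.

End linear_image.

(** * Ridge functions and the final bound *)

Section ridge.
Variables (R : realType) (r : nat) (g : 'cV[R]_r -> R) (C alpha : R).
Hypothesis hg : forall y y' : 'cV[R]_r,
  `|g y - g y'| <= C * euclidean_norm (y - y') `^ alpha.

(** Changing [x_j] moves [Theta^T x] along the [j]-th row of [Theta], so the Euclidean distance is
    exactly the norm of that row times [|z - t|]. *)
Lemma ridge_upd d (Theta : 'M[R]_(d, r)) (j : 'I_d) (x : 'cV[R]_d) z t :
  `|ridge Theta g (upd x j z) - ridge Theta g (upd x j t)| <=
  C * Num.sqrt (\sum_k Theta j k ^+ 2) `^ alpha * `|z - t| `^ alpha.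
Proof.
apply: le_trans (hg _ _) _.
rewrite -mulmxBr -mulrA -powRM ?sqrtr_ge0//.
rewrite le_eqVlt; apply/orP; left; apply/eqP; congr (C * _ `^ alpha).
rewrite /euclidean_norm.
have -> : \sum_i (Theta^T *m (upd x j z - upd x j t)) i 0 ^+ 2 =
    (\sum_k Theta j k ^+ 2) * (z - t) ^+ 2.
  rewrite mulr_suml; apply: eq_bigr => k _; rewrite -exprMn; congr (_ ^+ 2).
  rewrite mxE (bigD1 j)//= !mxE eqxx big1 ?addr0// => i ij.
  by rewrite !mxE (negbTE ij) subrr mulr0.
by rewrite sqrtrM ?sqrtr_sqr// sumr_ge0// => k _; rewrite sqr_ge0.
Qed.

Lemma ridge_holder d (Theta : 'M[R]_(d, r)) : holder alpha (ridge Theta g).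
Proof.
pose L j := C * Num.sqrt (\sum_k Theta j k ^+ 2) `^ alpha.
exists (\sum_j `|L j|); first exact: sumr_ge0.
move=> x y.
(* A path from [x] to [y] that changes one coordinate at a time, so that [ridge_upd] bounds each
   increment of the telescoping sum. *)
pose p n : 'cV[R]_d := \col_i (if (i < n)%N then y i 0 else x i 0).
have p0 : p 0%N = x by apply/colP => i; rewrite mxE ltn0.
have pd : p d = y by apply/colP => i; rewrite mxE ltn_ord.
have -> : ridge Theta g x - ridge Theta g y =
    \sum_(i < d) (ridge Theta g (p i) - ridge Theta g (p i.+1)).
  rewrite -{1}p0 -{1}pd -opprB.
  rewrite -(telescope_sumr (fun n => ridge Theta g (p n)) (leq0n d)) -sumrN big_mkord.
  by apply: eq_bigr => i _; rewrite opprB.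
apply: le_trans (ler_norm_sum _ _ _) _.
rewrite mulr_sumr; apply: ler_sum => i _.
have -> : p i = upd (p i) i (x i 0).
  by apply/colP => k; rewrite !mxE; case: eqP => // ->; rewrite ltnn.
have -> : p i.+1 = upd (p i) i (y i 0).
  apply/colP => k; rewrite !mxE ltnS leq_eqVlt.
  have [->|ki] := eqVneq k i; first by rewrite eqxx.
  by move: ki; rewrite -val_eqE /= => /negbTE ->.
apply: le_trans (ridge_upd _ _ _ _ _) _; rewrite -/(L i).
apply: ler_wpM2r; first exact: powR_ge0.
rewrite (le_trans (ler_norm _))// (bigD1 i)//= lerDl; exact: sumr_ge0.
Qed.

Lemma holder_of_euclidean : holder alpha g.
Proof.
have := ridge_holder (1%:M : 'M[R]_r); rewrite (_ : ridge 1%:M g = g)//.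
by apply/funext => x; rewrite /ridge trmx1 mul1mx.
Qed.

End ridge.

(** [E] integrates nonnegative functions against the law of [Theta^T x], written without [Theta],
    [d] or [P]. Since [g] is signed, its mean [m] is assembled from its two parts. *)
Lemma variance_ridge (R : realType) (d r : nat) (Theta : 'M[R]_(d, r))
    (g : 'cV[R]_r -> R) disp (T : measurableType disp) (P : probability T R)
    (X : 'I_d -> {RV P >-> R}) :
  standard_gaussian P X -> Theta^T *m Theta = 1%:M -> vec_measurable g ->
  let E h := smooths [seq delta_mx k 0 | k <- enum 'I_r] h 0 in
  let m := fine (E ((EFin \o g)^\+) - E ((EFin \o g)^\-))%E in
  'V_P[ridge Theta g \o random_vector P X]%E = E (fun y => ((g y - m) ^+ 2)%:E).
Proof.
move=> hX hTheta mg E m.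
have eE (h : 'cV[R]_r -> \bar R) : nnmeas h ->
    (\int[P]_w h (Theta^T *m random_vector P X w) = E h)%E.
  exact: integral_orthonormal.
have mEg : vec_measurable (EFin \o g).
  by apply: (vec_measurable_comp (g := EFin)) => //; exact/measurable_EFinP.
have npos : nnmeas ((EFin \o g)^\+)%E.
  split; last by move=> y; exact: funepos_ge0.
  move=> d' S Y mY; rewrite [X in measurable_fun _ X](_ : _ =
      ((fun p => (g (\col_i Y i p))%:E)^\+)%E); last first.
    by apply/funext => p; rewrite !funeposE.
  by apply: measurable_funepos; exact: (mEg _ S Y mY).
have nneg : nnmeas ((EFin \o g)^\-)%E.
  split; last by move=> y; exact: funeneg_ge0.
  move=> d' S Y mY; rewrite [X in measurable_fun _ X](_ : _ =
      ((fun p => (g (\col_i Y i p))%:E)^\-)%E); last first.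
    by apply/funext => p; rewrite !funenegE.
  by apply: measurable_funeneg; exact: (mEg _ S Y mY).
rewrite varianceE_integral.
have -> : \int[P]_v (ridge Theta g \o random_vector P X) v = m.
  rewrite /m -(eE _ npos) -(eE _ nneg) /Rintegral integralE.
  by congr (fine (_ - _)%E); apply: eq_integral => w _; rewrite ?funeposE ?funenegE.
apply: eE; split; last by move=> y; rewrite lee_fin sqr_ge0.
apply: (vec_measurable_comp (g := fun t : R => ((t - m) ^+ 2)%:E)) => //.
by apply/measurable_EFinP; apply: measurable_funX; exact: measurable_funB.
Qed.

Theorem theorem3p1 (R : realType) (d r : nat) (hr : (1 <= r)%N) (hrd : (r <= d)%N)
    (Theta : 'M[R]_(d, r)) (hTheta : Theta^T *m Theta = 1%:M)
    (g : 'cV[R]_r -> R) (C alpha : R) (halpha : 0 < alpha <= 1)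
    (hg : forall y y' : 'cV[R]_r,
      `|g y - g y'| <= C * euclidean_norm (y - y') `^ alpha)
    (disp : measure_display) (T : measurableType disp) (P : probability T R)
    (X : 'I_d -> {RV P >-> R}) (hX : standard_gaussian P X)
    (hvar : (0 < 'V_P[ridge Theta g \o random_vector P X])%E) :
  let sigma := Num.sqrt (fine 'V_P[ridge Theta g \o random_vector P X]) in
  mean_dimension P X (ridge Theta g)
    <= (C / sigma) ^+ 2 * 2 `^ (alpha - 1) * gaussian_abs_moment (2 * alpha)
       * \sum_(j < d) (\sum_(k < r) Theta j k ^+ 2) `^ alpha
  /\
  (* sigma^2 does not depend on d *)
  (forall (d' : nat) (Theta' : 'M[R]_(d', r)), (r <= d')%N ->
     Theta'^T *m Theta' = 1%:M ->
   forall (disp' : measure_display) (T' : measurableType disp')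
     (P' : probability T' R) (X' : 'I_d' -> {RV P' >-> R}),
     standard_gaussian P' X' ->
     'V_P'[ridge Theta' g \o random_vector P' X']
     = 'V_P[ridge Theta g \o random_vector P X]).
Proof.
have hholder := ridge_holder hg Theta.
have mg := holder_measurable halpha (holder_of_euclidean hg).
move=> sigma; split; last first.
  move=> d' Theta' _ hTheta' disp' T' P' X' hX'.
  by rewrite (variance_ridge hX' hTheta' mg) (variance_ridge hX hTheta mg).
have := mean_dimension_le hX halpha hholder (ridge_upd hg Theta) hvar.
congr (_ <= _); rewrite expr_div_n sqr_sqrtr ?fine_ge0 ?ltW//.
have -> : \sum_j (C * Num.sqrt (\sum_k Theta j k ^+ 2) `^ alpha) ^+ 2 =
    C ^+ 2 * \sum_j (\sum_k Theta j k ^+ 2) `^ alpha.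
  rewrite mulr_sumr; apply: eq_bigr => j _; rewrite exprMn; congr (_ * _).
  rewrite -powR_mulrn ?powR_ge0// powRAC powR_mulrn ?sqrtr_ge0// sqr_sqrtr//.
  by apply: sumr_ge0 => k _; exact: sqr_ge0.
by ring.
Qed.
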